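(* Let $K$ be a field, let $t\ge 3$ be an integer, and let $C_t$ denote the cycle on $t$ vertices. Then the ideal $I(C_t)^2$ is Cohen--Macaulay if and only if $t=5$.
   Context: For a finite simple graph $G$ with vertex set $V$ and edge set $E(G)$, the edge ideal $I(G)\subseteq S=K[v : v\in V]$ is generated by the monomials $vw$ with $\{v,w\}\in E(G)$. An ideal $J\subseteq S$ is called Cohen--Macaulay if $S/J$ is a Cohen--Macaulay ring. *)

(* Defs.v *)
From HB Require Import structures.
From mathcomp Require Import all_boot all_order all_algebra ring_quotient.
From mathcomp Require Import boolp.
From mathcomp Require Import mpoly.

Set Implicit Arguments.
Unset Strict Implicit.
Unset Printing Implicit Defensive.

Import GRing.Theory.
Local Open Scope ring_scope.

(* Ideals are boolean predicates, as in [ring_quotient]; with the classical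
   [asbool] of [boolp] this is no restriction.  An [idealr R] is a proper ideal
   and a [prime_idealr R] a prime ideal of R. *)

Section Ideals.
Variable R : comNzRingType.

Definition ideal_span (G : R -> Prop) : {pred R} :=
  fun x => `[< exists s : seq (R * R),
                 (forall p, p \in s -> G p.2) /\ x = \sum_(p <- s) p.1 * p.2 >].

Definition ideal_of_seq (s : seq R) : {pred R} := ideal_span (fun x => x \in s).

Definition ideal_mul (I J : {pred R}) : {pred R} :=
  ideal_span (fun x => exists a b, [/\ a \in I, b \in J & x = a * b]).

Lemma ideal_span0 G : 0 \in ideal_span G.
Proof. by apply/asboolP; exists [::]; split=> //; rewrite big_nil. Qed.

Lemma ideal_spanP G a :
  {in ideal_span G &, forall u v, a * u + v \in ideal_span G}.
Proof.
move=> u v /asboolP[s [Gs ->]] /asboolP[s' [Gs' ->]]; apply/asboolP.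
exists ([seq (a * p.1, p.2) | p <- s] ++ s'); split=> [p|].
  by rewrite mem_cat => /orP[/mapP[q qs ->] /=|]; [exact: Gs | exact: Gs'].
rewrite big_cat big_map mulr_sumr /=; congr (_ + _).
by apply: eq_bigr => p _; rewrite mulrA.
Qed.

Lemma ideal_span_sub (G : R -> Prop) (I : idealr R) :
  (forall x, G x -> x \in I) -> {subset ideal_span G <= I}.
Proof.
move=> GI x /asboolP[s [Gs ->]]; rewrite big_seq.
by apply: rpred_sum => p ps; apply/idealMr/GI/Gs.
Qed.

Definition maximal_ideal (M : idealr R) : Prop :=
  forall N : idealr R, {subset M <= N} -> {subset N <= M}.

(* The unit ideal, which is not an [idealr], is generated by 1. *)
Definition noetherian : Prop :=
  forall I : idealr R, exists s : seq R, I =i ideal_of_seq s.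

Definition regular_sequence (s : seq R) : Prop :=
  1 \notin ideal_of_seq s /\
  forall i, (i < size s)%N -> forall r : R,
    r * s`_i \in ideal_of_seq (take i s) -> r \in ideal_of_seq (take i s).

Definition is_depth (I : idealr R) (d : nat) : Prop :=
  (exists s, [/\ {subset s <= I}, regular_sequence s & size s = d]) /\
  (forall s, {subset s <= I} -> regular_sequence s -> (size s <= d)%N).

Definition prime_chain (P : idealr R) (n : nat) : Prop :=
  exists c : nat -> prime_idealr R,
    (forall i, (i < n)%N ->
       {subset c i <= c i.+1} /\ ~ {subset c i.+1 <= c i}) /\ c n =i P.

Definition is_height (P : idealr R) (h : nat) : Prop :=
  prime_chain P h /\ (forall n, prime_chain P n -> (n <= h)%N).

(* As in Eisenbud, Commutative Algebra, Section 18.2: a Noetherian ring such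
   that depth(M, R) = codim M for every maximal ideal M, where depth(M, R) is
   the maximal length of a regular sequence in M and codim M = dim R_M is the
   maximal length of a chain of primes descending from M. *)
Definition cohen_macaulay : Prop :=
  noetherian /\
  forall M : idealr R, maximal_ideal M ->
    exists d, is_depth M d /\ is_height M d.

End Ideals.

Section IdealMul.
Variables (R : comNzRingType) (I J : idealr R).

Lemma ideal_mul_idealr : idealr_closed (ideal_mul I J).
Proof.
split; [exact: ideal_span0 | | exact: ideal_spanP].
apply/negP => /(ideal_span_sub (I := I)) H; have := idealr1 I; rewrite H //.
by move=> x [a [b [aI _ ->]]]; rewrite mulrC; apply: idealMr.
Qed.

HB.instance Definition _ := isIdealr.Build R (ideal_mul I J) ideal_mul_idealr.
End IdealMul.

Section EdgeIdeal.
Variables (K : fieldType) (n : nat) (e : rel 'I_n).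

Definition edge_ideal : {pred {mpoly K[n]}} :=
  ideal_span (fun f => exists i j : 'I_n, e i j /\ f = 'X_i * 'X_j).

Lemma edge_ideal_idealr : idealr_closed edge_ideal.
Proof.
split; [exact: ideal_span0 | | exact: ideal_spanP].
apply/negP => /asboolP[s [Gs]] /(congr1 (meval (fun=> 0))) /eqP.
rewrite meval1 raddf_sum big_seq big1 ?oner_eq0 // => p /Gs[i [j [_ ->]]].
by rewrite [LHS](mevalM (fun=> 0)) mevalM mevalXU mul0r mulr0.
Qed.

HB.instance Definition _ :=
  isIdealr.Build {mpoly K[n]} edge_ideal edge_ideal_idealr.
End EdgeIdeal.

Arguments edge_ideal K {n} e.

(* [ordS] is the successor modulo n. *)
Definition cycle_graph (n : nat) : rel 'I_n :=
  fun i j => (j == ordS i) || (i == ordS j).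

Lemma cycle_graph_sym n : ssrbool.symmetric (@cycle_graph n).
Proof. by move=> i j; rewrite /cycle_graph orbC. Qed.

Lemma cycle_graph_irr n : (1 < n)%N -> irreflexive (@cycle_graph n).
Proof.
move=> n1 i; rewrite /cycle_graph orbb -val_eqE /=; apply/negbTE.
have [lt|] := ltnP i.+1 n; first by rewrite modn_small // neq_ltn ltnSn.
move=> ni; have ni1 : i.+1 = n by apply/eqP; rewrite eqn_leq ni ltn_ord.
rewrite ni1 modnn; apply: contraTneq n1 => i0.
by rewrite -ni1 i0.
Qed.

(* Main.v *)
(* Depth is bounded from above in two ways. If a nonzero monomial u of S/I^2 is
   killed by all variables outside a set W, then any elements g_1, ..., g_r with
   r > #|W| satisfy a nonzero polynomial relation modulo these variables;
   evaluating it on a regular sequence and peeling off the lowest power of one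
   element at a time gives u in (g_1, ..., g_r), and, since powers of a regular
   sequence are regular, u lies in every power of the irrelevant ideal: a
   contradiction. A maximal independent set W smaller than t./2 (for t = 3 the
   empty set, with u = x0 x1 x2) rules out every t except 4, 5 and 7. For t = 4
   and t = 7 an explicit Koszul cocycle of degree 1, respectively 2, is not a
   coboundary, so the depth is at most 1, respectively 2. In all cases the
   independent set of even vertices gives height at least t./2.

   For t = 5 put th1 = x0 + x4 + x3 and th2 = x2 + x1 + x3. Then S/I^2 is free
   over A = K[th1, th2] with basis the 20 monomials of degree at most 3 in
   x4, x1, x3: modulo th1, th2 the ideal I^2 becomes the fourth power of the
   maximal ideal, which gives generation, and independence says that a cubic
   with five double points in general position in 3-space (one for each minimal
   prime of I) is zero. A maximal ideal contains nonzero p(th1) and q(th2) by a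
   two-variable Nullstellensatz, and these form a regular sequence. *)
Require Import Defs.
From HB Require Import structures.
From mathcomp Require Import all_boot all_order all_algebra ring_quotient.
From mathcomp Require Import boolp.
From mathcomp Require Import mpoly.
From mathcomp Require Import zify ring.
From mathcomp Require classical_sets.

Set Implicit Arguments.
Unset Strict Implicit.
Unset Printing Implicit Defensive.

Import GRing.Theory.
Local Open Scope ring_scope.

(** * Ideals *)

Section Ideals.
Variable R : comNzRingType.
Implicit Types (J : R -> Prop) (s : seq R) (I M : idealr R).

(** [cohen_macaulay] quantifies over every maximal ideal, and K is arbitrary. The negative cases
    only need the irrelevant ideal. For t = 5 the other maximal ideals, possibly without K-rational
    points, are the reason why th1 and th2 give way to p(th1) and q(th2). There depth is bounded by
    height: a regular sequence in M produces a chain of primes below M. The height is in turn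
    bounded by the same device as the depth, a polynomial relation among more than #|W| elements: a
    chain of primes serves as well as a regular sequence, since an element of one prime outside the
    previous prime is a nonzerodivisor modulo the latter.

    The values 4, 5 and 7 resist the monomial argument because the smallest maximal independent set
    of a cycle has ceil(t / 3) vertices, and for t > 3 this is below [t./2] except in these three
    cases.

    Ideals inside the proof are [Prop]-valued and may be the unit ideal, since properness is often
    unknown when they are built. *)

Definition is_ideal J := J 0 /\ forall a u v, J u -> J v -> J (a * u + v).

Definition is_prime J :=
  [/\ is_ideal J, ~ J 1 & forall u v, J (u * v) -> J u \/ J v].

Lemma ideal0 J : is_ideal J -> J 0. Proof. by case. Qed.

Lemma idealMl J a u : is_ideal J -> J u -> J (a * u).
Proof. by move=> [J0 JP] Ju; rewrite -[a * u]addr0; apply: JP. Qed.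

Lemma ideal_mulr J a u : is_ideal J -> J u -> J (u * a).
Proof. by rewrite mulrC; apply: idealMl. Qed.

Lemma idealD J u v : is_ideal J -> J u -> J v -> J (u + v).
Proof. by move=> [J0 JP] Ju; rewrite -[u]mul1r; apply: JP. Qed.

Lemma idealN J u : is_ideal J -> J u -> J (- u).
Proof. by rewrite -mulN1r; apply: idealMl. Qed.

Lemma idealB J u v : is_ideal J -> J u -> J v -> J (u - v).
Proof. by move=> iJ Ju Jv; apply: idealD => //; apply: idealN. Qed.

Lemma idealBr J u v : is_ideal J -> J (u - v) -> J v -> J u.
Proof. by move=> iJ Jd Jv; rewrite -[u](subrK v); apply: idealD. Qed.

Lemma ideal_sum J (T : eqType) (r : seq T) (F : T -> R) :
  is_ideal J -> (forall i, i \in r -> J (F i)) -> J (\sum_(i <- r) F i).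
Proof.
move=> iJ JF; rewrite big_seq; elim/big_ind: _ => //; first exact: ideal0.
by move=> *; apply: idealD.
Qed.

Lemma idealr_ideal I : is_ideal (fun x => x \in I).
Proof.
split=> [|a u v uI vI]; first exact: idealr0.
by rewrite rpredD // idealMr.
Qed.

Lemma ideal_span_ideal G : is_ideal (fun x : R => x \in ideal_span G).
Proof.
by split=> [|a u v]; [exact: ideal_span0 | exact: ideal_spanP].
Qed.

Lemma mem_ideal_span (G : R -> Prop) x : G x -> x \in ideal_span G.
Proof.
move=> Gx; apply/asboolP; exists [:: (1, x)]; split.
  by move=> p; rewrite inE => /eqP->.
by rewrite big_seq1 mul1r.
Qed.

Lemma ideal_span_min (G : R -> Prop) J x : is_ideal J ->
  (forall y, G y -> J y) -> x \in ideal_span G -> J x.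
Proof.
move=> iJ GJ /asboolP[s [Gs ->]]; apply: ideal_sum => // p ps.
by apply: idealMl iJ _; apply/GJ/Gs.
Qed.

Lemma ideal_of_seq_ideal s : is_ideal (fun x : R => x \in ideal_of_seq s).
Proof. exact: ideal_span_ideal. Qed.

Lemma mem_ideal_of_seq s x : x \in s -> x \in ideal_of_seq s.
Proof. by move=> xs; apply: mem_ideal_span. Qed.

Lemma ideal_of_seq_min s J x : is_ideal J ->
  (forall y, y \in s -> J y) -> x \in ideal_of_seq s -> J x.
Proof. exact: ideal_span_min. Qed.

Lemma ideal_of_seqS s s' : {subset s <= s'} ->
  {subset ideal_of_seq s <= ideal_of_seq s'}.
Proof.
move=> ss' x.
apply: (@ideal_of_seq_min _ (fun x => x \in ideal_of_seq s')).
  exact: ideal_of_seq_ideal.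
by move=> y /ss'; apply: mem_ideal_of_seq.
Qed.

Lemma ideal_of_seq_cons g s x :
  x \in ideal_of_seq (g :: s) <-> exists y, x - y * g \in ideal_of_seq s.
Proof.
split; last first.
  move=> [y xs]; apply: (idealBr (ideal_of_seq_ideal _) (v := y * g)).
    by apply: ideal_of_seqS xs => z zs; rewrite inE zs orbT.
  apply: (idealMl _ (ideal_of_seq_ideal _)).
  by apply: mem_ideal_of_seq; rewrite mem_head.
apply: (@ideal_of_seq_min _ (fun x => exists y, x - y * g \in ideal_of_seq s)).
  split=> [|a u v [y uy] [z vz]].
    by exists 0; rewrite mul0r subr0 ideal_span0.
  exists (a * y + z).
  have -> : a * u + v - (a * y + z) * g = a * (u - y * g) + (v - z * g) by ring.
  exact: (ideal_of_seq_ideal _).2.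
move=> y; rewrite inE => /orP[/eqP->|ys].
  by exists 1; rewrite mul1r subrr ideal_span0.
by exists 0; rewrite mul0r subr0; apply: mem_ideal_of_seq.
Qed.

Lemma ideal_of_seq_nil x : x \in ideal_of_seq [::] <-> x = 0 :> R.
Proof.
split=> [|->]; last exact: ideal_span0.
apply: (@ideal_of_seq_min _ (fun x => x = 0)) => //.
by split=> // a u v -> ->; rewrite mulr0 addr0.
Qed.

Lemma ideal_of_seq_rcons g s x :
  x \in ideal_of_seq (rcons s g) <-> exists y, x - y * g \in ideal_of_seq s.
Proof.
rewrite -ideal_of_seq_cons; split; apply: ideal_of_seqS => y;
  by rewrite mem_rcons.
Qed.

Lemma ideal_asidealr J : is_ideal J -> ~ J 1 ->
  exists I, forall x, x \in I <-> J x.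
Proof.
move=> iJ J1.
have cl : idealr_closed (fun x => `[< J x >]).
  split; first by apply/asboolP; exact: ideal0.
    by apply/negP => /asboolP.
  by move=> a u v /asboolP Ju /asboolP Jv; apply/asboolP; apply: iJ.2.
pose mI := isIdealr.Build R _ cl.
pose I : idealr R := HB.pack (fun x => `[< J x >] : bool) mI.
by exists I => x; split => /asboolP.
Qed.

Lemma prime_asidealr J : is_prime J ->
  exists I : prime_idealr R, forall x, x \in I <-> J x.
Proof.
move=> [iJ J1 JM]; have [I IJ] := ideal_asidealr iJ J1.
have cl : prime_idealr_closed (fun x => x \in I).
  by move=> u v /IJ/JM[] /IJ ->; rewrite ?orbT.
pose mP := isPrimeIdealrClosed.Build R _ cl.
pose P : prime_idealr R := HB.pack (fun x => x \in I) I mP.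
by exists P => x; rewrite -IJ.
Qed.

Lemma prime_idealr_prime (P : prime_idealr R) : is_prime (fun x => x \in P).
Proof.
split; [exact: idealr_ideal | by rewrite idealr1 |].
by move=> u v; rewrite prime_idealrM => /orP.
Qed.

Lemma maximal_inv M x : maximal_ideal M -> x \notin M ->
  exists b, b * x - 1 \in M.
Proof.
move=> maxM xM; pose J y := exists b, y - b * x \in M.
have iJ : is_ideal J.
  split=> [|a u v [b ub] [c vc]]; first by exists 0;
    rewrite mul0r subr0 idealr0.
  exists (a * b + c).
  have -> : a * u + v - (a * b + c) * x = a * (u - b * x) + (v - c * x) by ring.
  by rewrite rpredD // idealMr.
have [[b]|J1] := EM (J 1).
  by rewrite -opprB rpredN => bM; exists b.
have [I IJ] := ideal_asidealr iJ J1.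
have IM : {subset I <= M}.
  by apply: maxM => y yM; apply/IJ; exists 0; rewrite mul0r subr0.
rewrite IM // in xM.
by apply/IJ; exists 1; rewrite mul1r subrr idealr0.
Qed.

Lemma maximal_prime M : maximal_ideal M -> is_prime (fun x => x \in M).
Proof.
move=> maxM; split; [exact: idealr_ideal | by rewrite idealr1 |].
move=> u v uvM; have [uM|uM] := boolP (u \in M); first by left.
right; have [b bM] := maximal_inv maxM uM.
have -> : v = b * (u * v) - v * (b * u - 1) by ring.
by rewrite rpredB // idealMr.
Qed.

End Ideals.

(** * Regular sequences and algebraic relations *)

Section RegularLadders.
Variable R : comNzRingType.
Implicit Types (J : R -> Prop) (s g : seq R).

Definition ideal_add J a : R -> Prop := fun x => exists y, J (x - y * a).

Definition nonzerodivisor_mod J a := forall r, J (r * a) -> J r.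

(** Common form of the partial ideals of a regular sequence and of a chain of primes with [a i]
    picked in [J i.+1] outside [J i]. For the latter, [J i.+1] must be allowed to be larger than the
    ideal generated by [J i] and [a i]. *)
Record ladder (n : nat) (J : nat -> R -> Prop) (a : nat -> R) : Prop := Ladder {
  ladder_ideal : forall i, (i <= n)%N -> is_ideal (J i);
  ladder_sub : forall i, (i < n)%N -> forall x, J i x -> J i.+1 x;
  ladder_mem : forall i, (i < n)%N -> J i.+1 (a i);
  ladder_reg : forall i, (i < n)%N -> nonzerodivisor_mod (J i) (a i) }.

Lemma ladder_behead n (J : nat -> R -> Prop) (a : nat -> R) :
  ladder n.+1 J a -> ladder n (fun i => J i.+1) (fun i => a i.+1).
Proof.
by case=> iJ JS Ja reg; split=> i ltin;
  [exact: iJ | exact: JS | exact: Ja | exact: reg].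
Qed.

Lemma ideal_add_ideal J a : is_ideal J -> is_ideal (ideal_add J a).
Proof.
move=> iJ; split=> [|b u v [y uy] [z vz]].
  by exists 0; rewrite mul0r subr0; apply: ideal0.
exists (b * y + z).
have -> : b * u + v - (b * y + z) * a = b * (u - y * a) + (v - z * a) by ring.
exact: iJ.2.
Qed.

Lemma ideal_add_sub J a x : J x -> ideal_add J a x.
Proof. by exists 0; rewrite mul0r subr0. Qed.

Lemma ideal_add_mem J a : is_ideal J -> ideal_add J a a.
Proof. by exists 1; rewrite mul1r subrr; apply: ideal0. Qed.

Lemma foldl_ideal_add_ideal J s :
  is_ideal J -> is_ideal (foldl ideal_add J s).
Proof. by elim: s J => //= a s IHs J iJ; apply/IHs/ideal_add_ideal. Qed.

Lemma foldl_ideal_add0 s x :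
  foldl ideal_add (fun x => x = 0) s x <-> x \in ideal_of_seq s.
Proof.
elim/last_ind: s x => [|s a IHs] x /=; first by rewrite ideal_of_seq_nil.
by rewrite foldl_rcons ideal_of_seq_rcons; split=> -[y /IHs Hy]; exists y.
Qed.

Fixpoint weakly_regular J s : Prop :=
  if s is a :: s' then nonzerodivisor_mod J a /\
    weakly_regular (ideal_add J a) s'
  else True.

Lemma weakly_regular_nth J s :
  (forall i, (i < size s)%N ->
     nonzerodivisor_mod (foldl ideal_add J (take i s)) s`_i) ->
  weakly_regular J s.
Proof.
elim: s J => //= a s IHs J reg; split; first exact: (reg 0%N isT).
by apply: IHs => i lti; apply: (reg i.+1).
Qed.

Lemma regular_weakly s : regular_sequence s -> weakly_regular (fun x =>
  x = 0) s.
Proof.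
move=> [_ reg]; apply: weakly_regular_nth => i lti r /foldl_ideal_add0 Hr.
by apply/foldl_ideal_add0; apply: reg.
Qed.

Lemma weakly_regular_ladder J s : is_ideal J -> weakly_regular J s ->
  ladder (size s) (fun i => foldl ideal_add J (take i s)) (nth 0 s).
Proof.
move=> iJ reg; split=> i lti.
- exact: foldl_ideal_add_ideal.
- by rewrite (take_nth 0) // foldl_rcons => x; apply: ideal_add_sub.
- rewrite (take_nth 0) // foldl_rcons; apply: ideal_add_mem.
  exact: foldl_ideal_add_ideal.
- elim: s J i lti iJ reg => //= a s IHs J [|i] lti iJ [rega reg].
    by rewrite /= ?take0.
  by apply: IHs => //; apply: ideal_add_ideal.
Qed.

Section Relations.
Variables (K : fieldType) (kappa : {rmorphism K -> R}) (N : nat).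

(** A polynomial with all exponents below [N], its coefficients indexed by exponent lists, evaluated
    at [g]. The nested form splits off one variable at a time. *)
Fixpoint eval_rel (c : seq nat -> K) g : R :=
  if g is a :: g' then \sum_(0 <= i < N) a ^+ i * eval_rel (c \o cons i) g'
  else kappa (c [::]).

Definition nontrivial_rel n (c : seq nat -> K) :=
  exists m, [/\ size m = n, all (ltn^~ N) m & c m != 0].

Lemma eval_rel0 g c : ~ nontrivial_rel (size g) c -> eval_rel c g = 0.
Proof.
elim: g c => [|a g IHg] c triv /=.
  have [->|c0] := eqVneq (c [::]) 0; first by rewrite rmorph0.
  by case: triv; exists [::].
rewrite big_nat big1 // => i /andP[_ iN]; rewrite IHg ?mulr0 // =>
  -[m [ms mN cm]].
by case: triv; exists (i :: m); rewrite /= ms iN.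
Qed.

(* Dividing out the power of [a] in the lowest nonzero coefficient of the
   relation and reducing modulo [a] eliminates one variable. *)
Lemma eval_rel_ladder g (J : nat -> R -> Prop) c u : ladder (size g)
  J (nth 0 g) ->
  nontrivial_rel (size g) c -> J 0 (eval_rel c g * u) -> J (size g) u.
Proof.
elim: g J c => [|a g IHg] J c lad nt /=.
  have [iJ _ _ _] := lad; case: nt => m [/size0nil ->
    _ c0] /(idealMl (kappa (c [::])^-1) (iJ 0 (leqnn 0))).
  by rewrite mulrA -rmorphM mulVf // rmorph1 mul1r.
have [iJ JS Ja reg] := lad.
pose P i := `[< (i < N)%N /\ nontrivial_rel (size g) (c \o cons i) >].
have exP : exists i, P i.
  case: nt => -[|i m] [] //= [ms] /andP[iN mN] cm.
  by exists i; apply/asboolP; split=> //; exists m.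
case: (ex_minnP exP) => i /asboolP[iN nti] imin.
rewrite (big_cat_nat _ (n := i)) //= ?(ltnW iN) // big_nat big1 ?add0r;
  last first.
  move=> k /andP[_ ki]; rewrite eval_rel0 ?mulr0 // => ntk.
  suff : (i <= k)%N by rewrite leqNgt ki.
  by apply: imin; apply/asboolP; split=> //; apply: ltn_trans iN.
rewrite big_ltn // => Jsum.
suff : J 1%N (eval_rel (c \o cons i) g * u).
  exact: (IHg (fun i => J i.+1)) (ladder_behead lad) nti.
pose b := \sum_(i.+1 <= k < N) a ^+ (k - i.+1) * eval_rel (c \o cons k) g.
have divJ k x : J 0%N (a ^+ k * x) -> J 0%N x.
  elim: k => [|k IHk]; first by rewrite mul1r.
  by rewrite exprS -mulrA mulrC => /(reg 0%N isT)/IHk.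
have : J 0%N ((eval_rel (c \o cons i) g + a * b) * u).
  apply: (divJ i); rewrite mulrA; congr (J 0%N (_ * u)): Jsum.
  rewrite mulrDr; congr (_ + _); rewrite mulrA -exprSr mulr_sumr.
  apply: eq_big_nat => k /andP[ik _].
  by rewrite mulrA -exprD subnKC.
move=> /(JS 0%N isT) => JS1; apply: (idealBr (iJ 1%N isT) (v := - (a * b * u))).
  by rewrite opprK -mulrDl.
by apply: idealN (iJ 1%N isT) _; rewrite -mulrA mulrC;
  apply: idealMl (iJ 1%N isT) (Ja 0%N isT).
Qed.

End Relations.
End RegularLadders.

Arguments ideal_add {R} J a _.

(** * Powers of regular sequences and chains of primes *)

Section RegularSequences.
Variable R : comNzRingType.
Implicit Types (J : R -> Prop) (s : seq R) (a b : R).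

Lemma ideal_addAC J a b x :
  ideal_add (ideal_add J a) b x <-> ideal_add (ideal_add J b) a x.
Proof.
by split=> -[y [z Jx]]; exists z, y; rewrite addrAC.
Qed.

Lemma foldl_ideal_add_cons J a s x :
  foldl ideal_add (ideal_add J a) s x <-> ideal_add (foldl ideal_add J s) a x.
Proof.
elim/last_ind: s x => [//|s b IHs] x; rewrite !foldl_rcons -ideal_addAC.
by split=> -[y /IHs Hy]; exists y.
Qed.

Lemma weakly_regular_rcons J s b :
  weakly_regular J (rcons s b) <->
  weakly_regular J s /\ nonzerodivisor_mod (foldl ideal_add J s) b.
Proof.
by elim: s J => [|a s IHs] J /=; [tauto | rewrite IHs; tauto].
Qed.

(* In a relation on a regular sequence each coefficient lies in the ideal of
   the other members, even without permutability. *)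
Lemma weakly_regular_colon J b s : is_ideal J -> weakly_regular J (b :: s) ->
  nonzerodivisor_mod (foldl ideal_add J s) b.
Proof.
move=> iJ; elim/last_ind: s => [|s k IHs]; first by case.
rewrite -rcons_cons weakly_regular_rcons => -[reg regk] z.
have iT := foldl_ideal_add_ideal s iJ.
rewrite !foldl_rcons => -[d Td].
have /regk/= /foldl_ideal_add_cons[e Te] : foldl ideal_add J (b :: s) (d * k).
  apply/foldl_ideal_add_cons; exists z.
  by rewrite -opprB; apply: (idealN iT Td).
exists e; apply: (IHs reg).
have -> : (z - e * k) * b = (z * b - d * k) + k * (d - e * b) by ring.
by apply: (idealD iT Td); apply: (idealMl _ iT Te).
Qed.

(** The factors are split off one by one. Let T be generated by J and [s], and let r k = w a b
    modulo T. Regularity with head b gives r = r' b; cancelling b by [weakly_regular_colon] leaves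
    r' k = w a, and regularity with head a gives r' = v a. *)
Lemma weakly_regularM J a b s : is_ideal J ->
  weakly_regular J (a :: s) -> weakly_regular J (b :: s) ->
  weakly_regular J (a * b :: s).
Proof.
move=> iJ; elim/last_ind: s => [|s k IHs].
  by case=> rega _ [regb _]; split=> // r; rewrite mulrA => /regb/rega.
rewrite -!rcons_cons !weakly_regular_rcons => -[rega regka] [regb regkb].
split; first exact: IHs.
move=> r /foldl_ideal_add_cons[w Tw]; apply/foldl_ideal_add_cons.
have iT := foldl_ideal_add_ideal s iJ.
have /regkb/foldl_ideal_add_cons[r' Tr'] : foldl ideal_add J (b :: s) (r * k).
  by apply/foldl_ideal_add_cons; exists (w * a); rewrite -mulrA.
have /regka/foldl_ideal_add_cons[v Tv] : foldl ideal_add J (a :: s) (r' * k).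
  apply/foldl_ideal_add_cons; exists w.
  apply: (weakly_regular_colon iJ regb).
  have -> : (r' * k - w * a) * b = (r * k - w * (a * b)) - k * (r - r' * b)
    by ring.
  by apply: (idealB iT Tw); apply: (idealMl _ iT Tr').
exists v.
have -> : r - v * (a * b) = (r - r' * b) + b * (r' - v * a) by ring.
by apply: (idealD iT Tr'); apply: (idealMl _ iT Tv).
Qed.

(** Once the head is raised to a power, the unchanged tail is still weakly regular modulo it, so the
    induction can go on to the tail. *)
Lemma weakly_regular_exp J s k : is_ideal J -> weakly_regular J s ->
  weakly_regular J [seq a ^+ k.+1 | a <- s].
Proof.
elim: s J => //= a s IHs J iJ reg.
suff [rega regs] : weakly_regular J (a ^+ k.+1 :: s).
  by split=> //; apply: IHs => //; apply: ideal_add_ideal.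
by elim: k {IHs} => [//|k IHk]; rewrite exprS; exact: weakly_regularM.
Qed.

(** P is an ideal containing J and maximal among those disjoint from the multiplicative set of all
    a^n w with w outside Q. J itself is disjoint from this set because [a] is a nonzerodivisor
    modulo J and J lies in Q. The elements with n = 0 force P into Q, and w = 1 keeps [a] out of
    P. *)
Lemma prime_separation J Q a : is_ideal J -> nonzerodivisor_mod J a ->
    is_prime Q -> (forall x, J x -> Q x) ->
  exists P, [/\ is_prime P, forall x, J x -> P x, forall x, P x -> Q x & ~ P a].
Proof.
move=> iJ rega [iQ Q1 QM] JQ.
pose T x := exists n (w : R), ~ Q w /\ x = a ^+ n * w.
have TM x y : T x -> T y -> T (x * y).
  move=> [n [s [sQ ->]]] [m [s' [s'Q ->]]]; exists (n + m)%N, (s * s'); split.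
    by move=> /QM[].
  by rewrite exprD; ring.
pose good (P : R -> Prop) :=
  [/\ is_ideal P, forall x, J x -> P x & forall x, P x -> ~ T x].
have goodJ : good J.
  split=> // x Jx [n [s [sQ xE]]]; apply/sQ/JQ; move: Jx; rewrite {}xE.
  by elim: n => [|n IHn]; rewrite ?mul1r // exprS -mulrA mulrC => /rega/IHn.
pose cand : classical_sets.set (classical_sets.set R) :=
  fun P => P = (fun=> False) \/ good P.
have [|P [candP maxP]] := @classical_sets.Zorn_bigcup _ cand.
  move=> F Fcand totF.
  have [[P FP gP]|nogood] := EM (exists2 P, F P & good P); last first.
    left; apply/funext => x; apply/propext; split=> // -[P FP Px].
    have [P0|gP] := Fcand P FP; first by rewrite P0 in Px.
    by case: nogood; exists P.
  right; split=> [|x Jx|x [P' FP' P'x]].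
  - split; first by exists P => //; case: gP => /ideal0.
    move=> b u v [P1 FP1 P1u] [P2 FP2 P2v].
    have mem P' : F P' -> forall x, P' x -> is_ideal P'.
      by move=> /Fcand[->|[]].
    have [P12|P21] := totF _ _ FP1 FP2.
      by exists P2 => //; apply: (mem _ FP2 _ P2v).2; [exact: P12 | exact: P2v].
    by exists P1 => //; apply: (mem _ FP1 _ P1u).2; [exact: P1u | exact: P21].
  - by exists P => //; case: gP => _ /(_ _ Jx).
  - have [P0|[_ _ PT]] := Fcand P' FP'; first by rewrite P0 in P'x.
    exact: PT.
have strict B : (forall x, P x -> B x) -> ~ (forall x, B x -> P x) ->
    classical_sets.proper P B.
  by move=> PB BP; split.
have [iP JP PT] : good P.
  case: candP => // P0; case: (maxP J); last by right.
  by apply: strict => [x|H]; [rewrite P0 | have := H _ (ideal0 iJ); rewrite P0].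
have PQ x : P x -> Q x.
  move=> Px; apply: contrapT => Qx; apply: (PT x Px).
  by exists 0%N, x; rewrite mul1r.
have meet u : ~ P u -> exists2 t, T t & ideal_add P u t.
  move=> nPu; apply: contrapT => nomeet; apply: (maxP (ideal_add P u)).
    apply: strict => [x|H]; first exact: ideal_add_sub.
    by apply/nPu/H; apply: ideal_add_mem.
  right; split=> [|x Jx|x Px Tx]; first exact: ideal_add_ideal.
    by apply/ideal_add_sub/JP.
  by apply: nomeet; exists x.
exists P; split=> //; last first.
  by move=> /PT; apply; exists 1%N, 1; rewrite mulr1 expr1.
split=> // [/PQ|u v Puv] //.
have [Pu|/meet[t Tt [y ty]]] := EM (P u); first by left.
have [Pv|/meet[t' Tt' [y' ty']]] := EM (P v); first by right.
case: (PT (t * t')); last exact: TM.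
have -> : t * t' = t' * (t - y * u) + y * u * (t' - y' * v) + y * y' * (u * v)
  by ring.
by apply: (idealD iP); [apply: (idealD iP)|]; apply: (idealMl _ iP).
Qed.

(** The chain is built downwards: [prime_separation] gives a prime between [J n] and M that misses
    [a n], an element of M, and this prime takes over the role of M. *)
Lemma ladder_prime_chain n (J : nat -> R -> Prop) (a : nat -> R) M :
    ladder n J a -> is_prime M -> (forall x, J n x -> M x) ->
  exists c : nat -> R -> Prop,
    [/\ forall i, is_prime (c i),
        forall i, (i < n)%N ->
          (forall x, c i x -> c i.+1 x) /\ ~ (forall x, c i.+1 x -> c i x) &
        c n = M].
Proof.
elim: n M => [|n IHn] M lad pM JM; first by exists (fun=> M).
have [iJ JS Ja reg] := lad.
have [P [pP JP PM Pa]] : exists P,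
  [/\ is_prime P, forall x, J n x -> P x, forall x, P x -> M x & ~ P (a n)].
  by apply: prime_separation (iJ _ _) (reg _ _) pM _ =>
    // x /(JS n (leqnn _))/JM.
have [|c [pc cS cP]] := IHn P _ pP JP.
  by split=> i lti; [apply: iJ | apply: JS | apply: Ja | apply: reg]; lia.
exists (fun i => if (i <= n)%N then c i else M); split=> [i|i|].
- by case: ifP.
- rewrite ltnS => /[dup] + lein; rewrite {1}leq_eqVlt => /predU1P[->|ltin];
    last by rewrite lein ltin; apply: cS.
  rewrite leqnn ltnn cP; split=> // MP; exact/Pa/MP/JM/Ja.
- by rewrite ltnn.
Qed.

End RegularSequences.

(** * Koszul cocycles *)

Section KoszulCocycles.
Variables (R : comNzRingType) (n : nat) (z : 'I_n -> R).
Implicit Types (J : R -> Prop) (g : R).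

Definition in_span g := exists c : 'I_n -> R, g = \sum_i c i * z i.

(** Two regular elements kill the first Koszul cohomology of z modulo J. Contracting the cocycle f
    with g1 gives F with z_i F = g1 f_i; contracting with g2 shows that g2 F is a multiple of g1, so
    F = r g1, and cancelling g1 leaves f_i = z_i r. *)
Lemma koszul_exact1 J g1 g2 (f : 'I_n -> R) : is_ideal J ->
    in_span g1 -> in_span g2 -> weakly_regular J [:: g1; g2] ->
    (forall i j, J (z j * f i - z i * f j)) ->
  exists r, forall i, J (f i - z i * r).
Proof.
move=> iJ [c1 g1E] [c2 g2E] /= [reg1 [reg2 _]] fJ.
pose F := \sum_i c1 i * f i.
have FJ i : J (z i * F - g1 * f i).
  have -> : z i * F - g1 * f i = \sum_j c1 j * (z i * f j - z j * f i).
    rewrite g1E mulr_sumr mulr_suml -sumrB; apply: eq_bigr => j _; ring.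
  by apply: ideal_sum => // j _; apply: idealMl.
have [r Fr] : ideal_add J g1 F.
  apply: reg2; exists (\sum_i c2 i * f i).
  have -> : F * g2 - (\sum_i c2 i * f i) * g1 =
            \sum_i c2 i * (z i * F - g1 * f i).
    rewrite g2E mulr_sumr mulr_suml -sumrB; apply: eq_bigr => i _; ring.
  by apply: ideal_sum => // i _; apply: idealMl.
exists r => i; apply: reg1.
have -> : (f i - z i * r) * g1 = z i * (F - r * g1) - (z i * F - g1 * f i)
  by ring.
by apply: (idealB iJ) => //; apply: idealMl.
Qed.

(** Contracting h with g1 gives e with g1 h_ij = z_j e_i - z_i e_j, so e is a 1-cocycle modulo J and
    g1. By [koszul_exact1] it equals z_i r + s_i g1; the term in r cancels from the coboundary, and
    then g1 can be cancelled. *)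
Lemma koszul_exact2 J g1 g2 g3 (h : 'I_n -> 'I_n -> R) : is_ideal J ->
    in_span g1 -> in_span g2 -> in_span g3 ->
    weakly_regular J [:: g1; g2; g3] ->
    (forall i j k, J (z k * h i j - z j * h i k + z i * h j k)) ->
  exists s : 'I_n -> R, forall i j, J (h i j - (z j * s i - z i * s j)).
Proof.
move=> iJ [c g1E] sp2 sp3 [reg1 reg] hJ.
pose e i := \sum_k c k * h i k.
have eJ i j : J (g1 * h i j - z j * e i + z i * e j).
  have -> : g1 * h i j - z j * e i + z i * e j =
            \sum_k c k * (z k * h i j - z j * h i k + z i * h j k).
    rewrite g1E mulr_suml !mulr_sumr -sumrB -big_split.
    by apply: eq_bigr => k _ /=; ring.
  by apply: ideal_sum => // k _; apply: idealMl.
have [|r er] := koszul_exact1 (ideal_add_ideal g1 iJ) sp2 sp3 reg (f := e).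
  move=> i j; exists (h i j); rewrite -opprB; apply: (idealN iJ).
  by have := eJ i j; congr J; ring.
have [s sE] := choice er; exists s => i j; apply: reg1.
have -> : (h i j - (z j * s i - z i * s j)) * g1 =
  (g1 * h i j - z j * e i + z i * e j) + z j * (e i - z i * r - s i * g1)
  - z i * (e j - z j * r - s j * g1) by ring.
by apply: (idealB iJ); [apply: (idealD iJ)|]; rewrite ?eJ //;
  apply: (idealMl _ iJ).
Qed.

End KoszulCocycles.

(** * The Hilbert basis theorem *)

Section Noetherian.

Lemma noetherianP (R : comNzRingType) : noetherian R <->
  forall J : R -> Prop, is_ideal J ->
    exists s : seq R, forall x, J x <-> x \in ideal_of_seq s.
Proof.
split=> noeR; last first.
  move=> I; have [s sE] := noeR _ (idealr_ideal I); exists s => x.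
  by apply/idP/idP => /sE.
move=> J iJ; have [J1|J1] := EM (J 1).
  exists [:: 1] => x; split=> _.
    by apply/ideal_of_seq_cons; exists x; rewrite mulr1 subrr ideal_span0.
  by rewrite -[x]mulr1; apply: idealMl.
have [I IJ] := ideal_asidealr iJ J1; have [s sE] := noeR I.
by exists s => x; rewrite -IJ sE.
Qed.

Lemma noetherian_surj (A B : comNzRingType) (phi : {rmorphism A -> B}) :
  (forall b, exists a, phi a = b) -> noetherian A -> noetherian B.
Proof.
move=> surj /noetherianP noeA; apply/noetherianP => J iJ.
have iJA : is_ideal (fun a => J (phi a)).
  split=> [|a u v Ju Jv]; first by rewrite rmorph0; apply: ideal0.
  by rewrite rmorphD rmorphM; apply: iJ.2.
have [s sE] := noeA _ iJA; exists (map phi s) => x; split; last first.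
  apply: ideal_of_seq_min => // _ /mapP[a sa ->].
  by apply/sE; apply: mem_ideal_of_seq.
have [a <-] := surj x => /sE.
apply: (@ideal_of_seq_min _ _ (fun a => phi a \in ideal_of_seq (map phi s))).
  split=> [|b u v us vs]; first by rewrite rmorph0 ideal_span0.
  by rewrite rmorphD rmorphM; apply: (ideal_of_seq_ideal _).2.
by move=> y ys; apply: mem_ideal_of_seq; apply: map_f.
Qed.

Lemma noetherian_field (K : fieldType) : noetherian K.
Proof.
apply/noetherianP => J iJ; have [[x Jx x0]|J0] := EM (exists2 x, J x & x != 0).
  exists [:: 1] => y; split=> _.
    by apply/ideal_of_seq_cons; exists y; rewrite mulr1 subrr ideal_span0.
  by rewrite -[y](divfK x0); apply: idealMl.
exists [::] => x; rewrite ideal_of_seq_nil; split=> [Jx|->]; last exact: ideal0.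
by apply: contrapT => /eqP x0; apply: J0; exists x.
Qed.

(** Hilbert's argument: the ideals [L d] of coefficients in degree d increase and become constant at
    some D. Generators lifted from [L d] for d up to D suffice, since they can cancel the leading
    term of any member of J. *)
Theorem noetherian_poly (R : comNzRingType) :
  noetherian R -> noetherian {poly R}.
Proof.
move=> /noetherianP noeR; apply/noetherianP => J iJ.
pose L d a := exists f : {poly R}, [/\ J f, (size f <= d.+1)%N & f`_d = a].
have iL d : is_ideal (L d).
  split=> [|a _ _ [f [Jf sf <-]] [g [Jg sg <-]]].
    by exists 0; rewrite size_poly0 coef0; split=> //; apply: ideal0.
  exists (a%:P * f + g); rewrite coefD coefCM; split=> //; first exact: iJ.2.
  by rewrite (leq_trans (size_polyD _ _)) // geq_max sg mul_polyC (leq_trans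
    (size_scale_leq _ _)).
have LS d e a : (d <= e)%N -> L d a -> L e a.
  move=> de [f [Jf sf <-]]; exists ('X^(e - d) * f); split.
  - exact: idealMl.
  - have [->|f0] := eqVneq f 0; first by rewrite mulr0 size_poly0.
    by rewrite mulrC size_mulXn //; lia.
  - by rewrite mulrC coefMXn ltnNge leq_subr /= subKn.
have iLL : is_ideal (fun a => exists d, L d a).
  split=> [|a u v [d Lu] [e Lv]]; first by exists 0%N; apply: ideal0 (iL 0%N).
  by exists (maxn d e); apply: (iL _).2; [apply: LS Lu | apply: LS Lv];
    rewrite ?leq_maxl ?leq_maxr.
have [D LD] : exists D, forall d a, L d a -> L D a.
  have [s sE] := noeR _ iLL.
  have [D sD] : exists D, forall a, a \in s -> L D a.
    have : forall a, a \in s -> exists d, L d a.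
      by move=> a sa; apply/sE; apply: mem_ideal_of_seq.
    elim: (s) => [|b r IHr] sL; first by exists 0%N.
    have [a ra|D LD] := IHr; first by apply: sL; rewrite inE ra orbT.
    have [d Lb] := sL b (mem_head _ _); exists (maxn d D) => a.
    rewrite inE => /predU1P[->|/LD]; first exact: LS (leq_maxl _ _) Lb.
    exact: LS (leq_maxr _ _).
  exists D => d a Lda; apply: (ideal_of_seq_min (iL D) sD).
  by apply/sE; exists d.
have /choice[F Fprop] d : exists F : seq {poly R}, {in F, forall f, J f} /\
    forall a, L d a -> exists f, [/\ f \in ideal_of_seq F,
      (size f <= d.+1)%N & f`_d = a].
  have [s sE] := noeR _ (iL d).
  have [F [FJ Fs]] : exists F : seq {poly R}, {in F, forall f, J f} /\
      {in s, forall a, exists2 f, f \in F & (size f <= d.+1)%N /\ f`_d = a}.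
    have : {in s, forall a, L d a}.
      by move=> a sa; apply/sE; apply: mem_ideal_of_seq.
    elim: (s) => [|b r IHr] sL; first by exists [::].
    have [a ra|F [FJ Fr]] := IHr; first by apply: sL; rewrite inE ra orbT.
    have [f [Jf sf fb]] := sL b (mem_head _ _); exists (f :: F); split.
      by move=> g; rewrite inE => /predU1P[->|/FJ].
    move=> a; rewrite inE => /predU1P[->|/Fr[g Fg gP]].
      by exists f; rewrite ?mem_head.
    by exists g; rewrite // inE Fg orbT.
  exists F; split=> // a /sE; apply: (@ideal_of_seq_min _ _ (fun a =>
    exists f, [/\ f \in ideal_of_seq F, (size f <= d.+1)%N & f`_d = a])).
    split=> [|b _ _ [f [Jf sf <-]] [g [Jg sg <-]]].
      by exists 0; rewrite ideal_span0 size_poly0 coef0.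
    exists (b%:P * f + g); rewrite coefD coefCM; split=> //.
      exact: (ideal_of_seq_ideal _).2.
    by rewrite (leq_trans (size_polyD _ _))
      // geq_max sg mul_polyC (leq_trans (size_scale_leq _ _)).
  by move=> _ /Fs[f Ff [sf <-]]; exists f; split=> //; apply: mem_ideal_of_seq.
exists (flatten [seq F d | d <- iota 0 D.+1]) => f; split; last first.
  apply: ideal_of_seq_min => // g /flattenP[_ /mapP[d _ ->]].
  by have [FJ _] := Fprop d; apply: FJ.
set G := flatten _.
have FG d g : (d <= D)%N -> g \in ideal_of_seq (F d) -> g \in ideal_of_seq G.
  move=> dD; apply: ideal_of_seqS => h hF; apply/flattenP; exists (F d) => //.
  by apply/mapP; exists d; rewrite // mem_iota.
have iG := ideal_of_seq_ideal G.
have FJ d g : g \in ideal_of_seq (F d) -> J g.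
  by apply: ideal_of_seq_min => // h; have [FJ _] := Fprop d; apply: FJ.
have [m] := ubnP (size f); elim: m f => // m IHm f; rewrite ltnS => sf Jf.
have [sfm|] := ltnP (size f) m.+1; last first.
  by move=> ms; have := leq_ltn_trans sf ms; rewrite ltnn.
move: sf; rewrite leq_eqVlt => /orP[/eqP sfm'|]; last by move=> ?; apply: IHm.
case: m => [|n] in IHm sfm sfm' *.
  by have/eqP := sfm'; rewrite size_poly_eq0 => /eqP->; apply: ideal_span0.
have Ln : L n f`_n by exists f; rewrite sfm'.
have [g [gG Jg sg gn]] : exists g,
    [/\ g \in ideal_of_seq G, J g, (size g <= n.+1)%N & g`_n = f`_n].
  have [nD|Dn] := leqP n D.
    have [_ /(_ _ Ln)[g [gF sg gn]]] := Fprop n.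
    by exists g; split=> //; [apply: FG gF | apply: FJ gF].
  have [_ /(_ _ (LD _ _ Ln))[g [gF sg gn]]] := Fprop D.
  exists ('X^(n - D) * g); split.
  - by apply: (idealMl _ iG); apply: FG gF.
  - by apply: (idealMl _ iJ); apply: FJ gF.
  - have [->|g0] := eqVneq g 0; first by rewrite mulr0 size_poly0.
    by rewrite mulrC size_mulXn //; lia.
  - by rewrite mulrC coefMXn ltnNge leq_subr /= subKn // ltnW.
apply: (idealBr iG _ gG); apply: IHm; last exact: idealB.
rewrite ltnS; apply/leq_sizeP => j; rewrite leq_eqVlt => /predU1P[<-|nj].
  by rewrite coefB gn subrr.
by rewrite coefB !nth_default ?subrr ?sfm' // (leq_trans sg).
Qed.

End Noetherian.

(** * Polynomial rings *)

Section Polynomials.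
Variable K : fieldType.

Lemma mpoly_gen_ind n (P : {mpoly K[n]} -> Prop) :
    (forall c, P c%:MP) -> (forall p q, P p -> P q -> P (p + q)) ->
    (forall i p, P p -> P ('X_i * p)) ->
  forall p, P p.
Proof.
move=> PC PD PX; elim/mpolyind => [|c m p _ _ Pp].
  by rewrite -(mpolyC0 n); apply: PC.
apply: PD => //; rewrite -mul_mpolyC mulrC mpolyXE_id.
move: (PC c); move: c%:MP; elim/big_rec: _ => [|i x _ IHx] q Pq.
  by rewrite mul1r.
rewrite -mulrA; elim: (m i) => [|k IHk]; first by rewrite mul1r; apply: IHx.
by rewrite exprS -mulrA; apply: PX.
Qed.

Lemma noetherian_mpoly n : noetherian {mpoly K[n]}.
Proof.
elim: n => [|n /noetherian_poly noeP].
  apply: (@noetherian_surj _ _ (@mpolyC 0 K)); last exact: noetherian_field.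
  elim/mpoly_gen_ind => [c|p q [a <-] [b <-]|[]//]; first by exists c.
  by exists (a + b); rewrite rmorphD.
pose x : {mpoly K[n.+1]} := 'X_ord_max.
pose phi := horner_eval x \o map_poly (@mwiden n K).
apply: (@noetherian_surj _ _ phi) noeP.
elim/mpoly_gen_ind => [c|p q [a <-] [b <-]|i p [a <-]].
- by exists (c%:MP)%:P; rewrite /phi /= /horner_eval map_polyC hornerC;
    apply: mwidenC.
- by exists (a + b); rewrite rmorphD.
- suff [b <-] : exists b, phi b = 'X_i by exists (b * a); rewrite rmorphM.
  have [j ->|->] := unliftP ord_max i.
    exists ('X_j)%:P; rewrite /phi /= /horner_eval map_polyC hornerC.
    rewrite [LHS]mwidenX mnmwiden1; congr 'X_[U_(_)]; apply: val_inj => /=.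
    by rewrite /bump leqNgt ltn_ord.
  by exists 'X; rewrite /phi /= /horner_eval map_polyX hornerX.
Qed.

(** * Setting the variables outside W to zero *)

Section Restriction.
Variables (n : nat) (W : {set 'I_n}).

Definition restrict : {mpoly K[n]} -> {mpoly K[n]} :=
  mmap (@mpolyC n K) (fun i => if i \in W then 'X_i else 0).

HB.instance Definition _ := GRing.RMorphism.on restrict.

Lemma restrictC c : restrict c%:MP = c%:MP. Proof. exact: mmapC. Qed.

Lemma restrictX i : restrict 'X_i = if i \in W then 'X_i else 0.
Proof. by rewrite /restrict mmapX mmap1U. Qed.

Lemma restrict_congr (J : {mpoly K[n]} -> Prop) f : is_ideal J ->
  (forall j, j \notin W -> J 'X_j) -> J (f - restrict f).
Proof.
move=> iJ JX; elim/mpoly_gen_ind: f => [c|p q Jp Jq|i p Jp].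
- by rewrite restrictC subrr; apply: ideal0.
- by rewrite rmorphD opprD addrACA; apply: idealD.
- rewrite rmorphM /= restrictX; case: ifPn => iW.
    by rewrite -mulrBr; apply: idealMl.
  by rewrite mul0r subr0 mulrC; apply: (idealMl _ iJ); apply: JX.
Qed.

(** A box instead of a total degree bound: the polynomials supported in it form a space of dimension
    (B + 1)^#|W|, which is easy to compare with a number of words. *)
Definition box_support B (p : {mpoly K[n]}) :=
  forall k, p@_k != 0 -> forall i, (k i <= if i \in W then B else 0)%N.

Lemma box_supportC c : box_support 0 c%:MP.
Proof.
move=> k; rewrite mcoeffC; have [-> _ i|] := eqVneq k 0%MM;
  last by rewrite mulr0 eqxx.
by rewrite mnm0E.
Qed.

Lemma box_supportS B C p : (B <= C)%N -> box_support B p -> box_support C p.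
Proof.
move=> BC bp k pk i; apply: leq_trans (bp k pk i) _; by case: ifP.
Qed.

Lemma box_supportD B p q :
  box_support B p -> box_support B q -> box_support B (p + q).
Proof.
move=> bp bq k; rewrite mcoeffD; have [->|pk _] := eqVneq p@_k 0;
  last exact: bp.
by rewrite add0r; apply: bq.
Qed.

Lemma box_supportM B C p q :
  box_support B p -> box_support C q -> box_support (B + C) (p * q).
Proof.
move=> bp bq k; rewrite -mcoeff_msupp => /msuppM_le/allpairsP[[k1 k2]] /= [].
rewrite !mcoeff_msupp => pk qk -> i; rewrite mnmDE.
have := leq_add (bp _ pk i) (bq _ qk i); by case: ifP.
Qed.

Lemma box_supportXn B p k : box_support B p -> box_support (k * B) (p ^+ k).
Proof.
move=> bp; elim: k => [|k IHk]; first by rewrite expr0 -mpolyC1;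
  apply: box_supportC.
by rewrite exprS mulSn; apply: box_supportM.
Qed.

Lemma box_support_restrict p : exists B, box_support B (restrict p).
Proof.
elim/mpoly_gen_ind: p => [c|p q [B bp] [C bq]|i p [B bp]].
- by exists 0%N; rewrite restrictC; apply: box_supportC.
- exists (maxn B C); rewrite rmorphD.
  by apply: box_supportD; [apply: box_supportS bp | apply: box_supportS bq];
    rewrite ?leq_maxl ?leq_maxr.
- exists (1 + B)%N; rewrite rmorphM /= restrictX; apply: box_supportM => //.
  case: ifPn => iW; last first.
    by apply: (@box_supportS 0) => //; rewrite -mpolyC0; apply: box_supportC.
  move=> k; rewrite mcoeffX; have [<- _ j|] := eqVneq U_(i)%MM k;
    last by rewrite eqxx.
  by rewrite mnm1E; have [<-|] := eqVneq i j; rewrite ?iW.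
Qed.

End Restriction.

(** * Algebraic dependence by counting monomials *)

Section AlgebraicDependence.
Variables (R : comNzRingType) (kappa : {rmorphism K -> R}) (N : nat).

Fixpoint words r : seq (seq nat) :=
  if r is r'.+1 then [seq i :: m | i <- iota 0 N, m <- words r'] else [:: [::]].

Lemma size_words r : size (words r) = (N ^ r)%N.
Proof. by elim: r => //= r IHr; rewrite size_allpairs size_iota IHr expnS. Qed.

Lemma mem_words r m : (m \in words r) = (size m == r) && all (ltn^~ N) m.
Proof.
elim: r m => [|r IHr] [|i m] //=; first by apply/allpairsP => -[[]] ? ? /= [].
rewrite eqSS; apply/allpairsP/idP => [[[j m'] /= [jN m'r [-> ->]]]|].
  by rewrite mem_iota add0n in jN; rewrite IHr in m'r;
    case/andP: m'r => -> ->; case/andP: jN => _ ->.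
move=> /and3P[mr iN mN]; exists (i, m); rewrite /= mem_iota iN IHr.
by rewrite mr mN.
Qed.

Lemma uniq_words r : uniq (words r).
Proof.
elim: r => //= r IHr; apply: allpairs_uniq => //; first exact: iota_uniq.
by move=> [i m] [j m'] _ _ /= [-> ->].
Qed.

Fixpoint word_value (m : seq nat) (g : seq R) : R :=
  match m, g with i :: m', a :: g' => a ^+ i * word_value m' g' | _, _ => 1 end.

Lemma eval_relE (c : seq nat -> K) g :
  eval_rel kappa N c g =
  \sum_(m <- words (size g)) kappa (c m) * word_value m g.
Proof.
elim: g c => [|a g IHg] c /=; first by rewrite big_seq1 mulr1.
rewrite big_allpairs_dep /index_iota subn0; apply: eq_bigr => i _.
rewrite IHg mulr_sumr; apply: eq_bigr => m _ /=.
by rewrite mulrCA.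
Qed.

End AlgebraicDependence.

Lemma rmorph_eval_rel (A B : comNzRingType) (f : {rmorphism A -> B})
    (kA : {rmorphism K -> A}) (kB : {rmorphism K -> B}) N c g :
  f \o kA =1 kB -> f (eval_rel kA N c g) = eval_rel kB N c (map f g).
Proof.
move=> fk; elim: g c => [|a g IHg] c /=; first by rewrite -fk.
rewrite rmorph_sum; apply: eq_bigr => i _.
by rewrite rmorphM rmorphXn IHg.
Qed.

Lemma box_support_word n (W : {set 'I_n}) D N g m :
  {in g, forall p, box_support W D p} -> size m = size g -> all (ltn^~ N) m ->
  box_support W (size g * (N * D)) (word_value m g).
Proof.
elim: g m => [|a g IHg] [|i m] //= gD; first by rewrite -mpolyC1 => *;
  apply: box_supportC.
move=> [ms] /andP[iN mN]; rewrite mulSn; apply: box_supportM.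
  apply: (@box_supportS _ _ (i * D)); first by rewrite leq_mul // ltnW.
  by apply/box_supportXn/gD; rewrite mem_head.
by apply: IHg => // p pg; apply: gD; rewrite inE pg orbT.
Qed.

(* There are N ^ d.+1 power products with exponents below N, but they lie in a
   space of dimension O(N ^ d). *)
Lemma algebraic_dependence n (W : {set 'I_n}) (g : seq {mpoly K[n]}) :
  (#|W| < size g)%N ->
  exists N c, nontrivial_rel N (size g) c /\
              restrict W (eval_rel (@mpolyC n K) N c g) = 0.
Proof.
move=> Wg; pose g' := map (restrict W) g.
have [D gD] : exists D, {in g', forall p, box_support W D p}.
  rewrite /g'; elim: (g) => [|p r [D rD]]; first by exists 0%N.
  have [B pB] := box_support_restrict W p; exists (maxn B D) => q.
  rewrite inE => /predU1P[->|/rD]; first exact/(box_supportS _ pB)/leq_maxl.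
  exact/box_supportS/leq_maxr.
(* With w = #|W| this N gives (r N D + 1)^w <= (r D + 1)^w N^w < N N^w <= N^r, so there are more
   words than monomials in the box. *)
set r := size g in Wg *; pose N := ((r * D).+1 ^ #|W|).+1.
pose E := (r * (N * D)).+1.
pose C := {ffun {i | i \in W} -> 'I_E}.
pose mono (f : C) : 'X_{1..n} :=
  [multinom (if insub i is Some j then f j : nat else 0%N) | i < n].
have monoE p k : box_support W E.-1 p -> p@_k != 0 -> exists f, k = mono f.
  move=> bp pk; exists [ffun j : {i | i \in W} => inord (k (val j))].
  apply/mnmP => i; rewrite mnmE; have := bp k pk i.
  case: insubP => [j iW <-|/negPf->]; last by rewrite leqn0 => /eqP.
  by rewrite (valP j) ffunE /E => ?; rewrite inordK.
have cardC : (#|C| < N ^ r)%N.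
  rewrite card_ffun card_ord card_sig -(subnK Wg) addnS expnS.
  have -> : #|[pred x | x \in W]| = #|W| by apply: eq_card.
  apply: (@leq_trans (N * N ^ #|W|)); last first.
    by rewrite leq_mul // leq_pexp2l // leq_addl.
  apply: (@leq_ltn_trans ((r * D).+1 ^ #|W| * N ^ #|W|)); last first.
    by rewrite ltn_pmul2r ?expn_gt0.
  rewrite -expnMn; case: (posnP #|W|) => [->//|W0].
  by rewrite leq_exp2r // /E mulSn (mulnC N D)
    mulnA -[X in (X < _)%N]add0n ltn_add2r.
pose A : 'M[K]_(N ^ r, #|C|) :=
  \matrix_(i, j) (word_value (nth [::] (words N r) i) g')@_(mono (enum_val j)).
have [v /sub_kermxP vA v0] : exists2 v : 'rV_(N ^ r),
  (v <= kermx A)%MS & v != 0.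
  apply/rowV0Pn; rewrite -mxrank_eq0 mxrank_ker subn_eq0 -ltnNge.
  exact: leq_ltn_trans (rank_leq_col _) cardC.
pose c m := if insub (index m (words N r)) is Some i then v 0 i else 0.
have cE (i : 'I_(N ^ r)) : c (nth [::] (words N r) i) = v 0 i.
  by rewrite /c index_uniq ?uniq_words ?size_words ?ltn_ord // valK.
have wi (i : 'I_(N ^ r)) : nth [::] (words N r) i \in words N r.
  by rewrite mem_nth // size_words.
exists N, c; split.
  have /rV0Pn[i vi] := v0; exists (nth [::] (words N r) i); rewrite cE.
  by have := wi i; rewrite mem_words => /andP[/eqP].
rewrite (rmorph_eval_rel _ _ (kB := @mpolyC n K)); last exact: restrictC.
rewrite eval_relE size_map -/r; apply/mpolyP => k; rewrite mcoeff0 raddf_sum /=.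
rewrite (big_nth [::]) size_words big_mkord.
have [[f kf]|nok] := EM (exists f, k = mono f).
  have /matrixP/(_ 0 (enum_rank f)) := vA; rewrite !mxE => vA0.
  apply: etrans vA0.
  by apply: eq_bigr => i _; rewrite mcoeffCM cE !mxE enum_rankK -kf.
apply: big1 => i _; rewrite mcoeffCM.
have [->|nz] := eqVneq (word_value (nth [::] (words N r) i) g')@_k 0.
  by rewrite mulr0.
case: nok; apply: monoE nz; have := wi i; rewrite mem_words =>
  /andP[/eqP si iN].
have := box_support_word gD (N := N) (m := nth [::] (words N r) i).
by rewrite size_map; apply.
Qed.

End Polynomials.

(** * Quotients of polynomial rings *)

Section QuotientMap.
Variables (R : comNzRingType) (I : idealr R).

Definition quotient_map : R -> {ideal_quot I} := \pi_{ideal_quot I}%qT.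

Lemma quotient_map_additive : additive quotient_map.
Proof. by move=> x y; rewrite /quotient_map !piE. Qed.

Lemma quotient_map_multiplicative : multiplicative quotient_map.
Proof. by split=> [x y|]; rewrite /quotient_map !piE. Qed.

HB.instance Definition _ := GRing.isAdditive.Build R {ideal_quot I}
  quotient_map quotient_map_additive.
HB.instance Definition _ := GRing.isMultiplicative.Build R {ideal_quot I}
  quotient_map quotient_map_multiplicative.

Lemma quotient_map_eq0 x : quotient_map x = 0 <-> x \in I.
Proof.
rewrite -[x in x \in I]subr0 Quotient.idealrBE.
have <- : quotient_map 0 = 0 by apply: rmorph0.
by split=> [E|/eqP]; first by apply/eqP.
Qed.

Lemma quotient_map_surj x : exists y, quotient_map y = x.
Proof. by exists (repr x); rewrite /quotient_map reprK. Qed.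

End QuotientMap.

Section CohenMacaulay.
Variable R : comNzRingType.
Implicit Types M : idealr R.

Lemma prime_chainP M n : prime_chain M n <->
  exists c : nat -> R -> Prop,
    [/\ forall i, is_prime (c i),
        forall i, (i < n)%N ->
          (forall x, c i x -> c i.+1 x) /\ ~ (forall x, c i.+1 x -> c i x) &
        forall x, c n x <-> x \in M].
Proof.
split=> [[c [cS cM]]|[c [pc cS cM]]].
  exists (fun i x => x \in c i); split=> [i|i ltin|x].
  - exact: prime_idealr_prime.
  - exact: cS.
  - by rewrite cM.
have [d dE] := choice (fun i => prime_asidealr (pc i)).
exists d; split=> [i ltin|x]; last by apply/idP/idP => [/dE/cM//|/cM/dE].
have [sub nsub] := cS i ltin; split=> [x /dE/sub/dE //|H].
by apply: nsub => x /dE/H/dE.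
Qed.

Lemma cohen_macaulay_regular_sequence M n :
    cohen_macaulay R -> maximal_ideal M -> prime_chain M n ->
  exists s, [/\ {subset s <= M}, regular_sequence s & (n <= size s)%N].
Proof.
move=> [_ cm] maxM chain; have [d [[[s [sM reg sd]] _] [_ ht]]] := cm M maxM.
by exists s; split; rewrite ?sd //; apply: ht.
Qed.

End CohenMacaulay.

(** * Bounds for depth and height in a quotient of a polynomial ring *)

Section PolynomialQuotient.
Variables (K : fieldType) (n : nat).
Notation S := {mpoly K[n]}.
Variables (Q : comNzRingType) (pi : {rmorphism S -> Q}) (I : S -> Prop).
Hypothesis pi_surj : forall x, exists f, pi f = x.
Hypothesis pi_eq0 : forall f, pi f = 0 <-> I f.

Let kappa := pi \o @mpolyC n K.

Lemma kernel_congr f g : pi f = pi g -> I (f - g).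
Proof. by move=> E; apply/pi_eq0; rewrite rmorphB E subrr. Qed.

Lemma pi_eval_rel N c g :
  pi (eval_rel (@mpolyC n K) N c g) = eval_rel kappa N c (map pi g).
Proof. exact: rmorph_eval_rel. Qed.

Lemma lift_seq (s : seq Q) : exists g, map pi g = s.
Proof.
elim: s => [|x s [g <-]]; first by exists [::].
by have [f <-] := pi_surj x; exists (f :: g).
Qed.

(** A longer chain would give more than #|W| elements [a i], hence a nontrivial relation among them
    modulo the variables outside W, which lie in the smallest prime. [eval_rel_ladder] would then
    put 1 into the largest prime. *)
Theorem prime_chain_leq (W : {set 'I_n}) m (c : nat -> Q -> Prop) :
    (forall i, is_prime (c i)) ->
    (forall i, (i < m)%N ->
       (forall x, c i x -> c i.+1 x) /\ ~ (forall x, c i.+1 x -> c i x)) ->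
    (forall j, j \notin W -> c 0%N (pi 'X_j)) ->
  (m <= #|W|)%N.
Proof.
move=> pc cS cX; rewrite leqNgt; apply/negP => Wm.
have ici i : is_ideal (c i) by case: (pc i).
have /choice[a aP] i : exists x, (i < m)%N -> c i.+1 x /\ ~ c i x.
  have [ltim|] := boolP (i < m)%N; last by exists 0.
  have [_ /existsNP[x /not_implyP[cx ncx]]] := cS i ltim.
  by exists x.
have [g gE] := lift_seq (mkseq a m).
have sg : size g = m by rewrite -(size_map pi) gE size_mkseq.
have [|N [r [ntr rE]]] := @algebraic_dependence K n W g; first by rewrite sg.
have lad : ladder (size (mkseq a m)) c (nth 0 (mkseq a m)).
  rewrite size_mkseq; split=> // i ltim.
  - by have [] := cS i ltim.
  - by rewrite nth_mkseq //; case: (aP i ltim).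
  - rewrite nth_mkseq // => x; have [_ _ cM] := pc i.
    by move=> /cM[] // cai; have [_] := aP i ltim.
have [_ c1 _] := pc (size (mkseq a m)); apply: c1.
apply: (eval_rel_ladder lad (kappa := kappa) (N := N) (c := r)).
  by rewrite size_mkseq -sg.
rewrite mulr1 -gE -pi_eval_rel.
have ipc : is_ideal (fun f => c 0%N (pi f)).
  split=> [|b u v Ju Jv]; first by rewrite rmorph0; apply: ideal0.
  by rewrite rmorphD rmorphM; apply: (ici _).2.
by have := restrict_congr (eval_rel (@mpolyC n K) N r g) ipc cX;
  rewrite rE subr0.
Qed.

Definition irrelevant (x : Q) := exists2 f : S, f@_0%MM = 0 & pi f = x.

Lemma mcoeff_exp_small (f : S) e k :
  f@_0%MM = 0 -> (mdeg k < e)%N -> (f ^+ e)@_k = 0.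
Proof.
move=> f0; elim: e k => // e IHe k ke; apply/eqP; rewrite exprS mcoeff_eq0.
apply/negP => /msuppM_le/allpairsP[[k1 k2] /= [fk1 fk2 kE]].
have k1_0 : k1 != 0%MM.
  by apply: contraTneq fk1 => ->; rewrite mcoeff_msupp f0 eqxx.
rewrite -mdeg_eq0 -lt0n in k1_0; move: ke; rewrite kE mdegD => ke.
by move: fk2; rewrite mcoeff_msupp IHe ?eqxx //; lia.
Qed.

(* Replacing the regular sequence by high powers forces the monomial, which
   every relation modulo the variables outside W annihilates, into a high
   power of the irrelevant ideal. *)
Theorem regular_sequence_leq (W : {set 'I_n}) (k : 'X_{1..n}) (s : seq Q) :
    (forall f, I f -> f@_k = 0) ->
    (forall j, j \notin W -> I ('X_j * 'X_[k])) ->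
    (forall x, x \in s -> irrelevant x) -> regular_sequence s ->
  (size s <= #|W|)%N.
Proof.
move=> Ik IX sM /regular_weakly reg; rewrite leqNgt; apply/negP => Ws.
(* With this exponent every element of the ideal of [s'] has a representative without monomials of
   degree up to [mdeg k]. The class of 'X_[k] has none, as the coefficient at k vanishes on I. *)
pose s' := [seq a ^+ (mdeg k).+1 | a <- s].
have i0 : is_ideal (fun x : Q => x = 0).
  by split=> // b u v -> ->; rewrite mulr0 addr0.
have lad := weakly_regular_ladder i0 (weakly_regular_exp (mdeg k) i0 reg).
rewrite -/s' in lad.
have [g gE] := lift_seq s'.
have sg : size g = size s' by rewrite -(size_map pi) gE.
have [|N [r [ntr rE]]] := @algebraic_dependence K n W g;
  first by rewrite sg size_map.
(* The colon ideal of 'X_[k] contains the variables outside W, hence also the relation, whose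
   restriction to W is zero. *)
have iI : is_ideal (fun f => I (f * 'X_[k])).
  split=> [|b u v /pi_eq0 Iu /pi_eq0 Iv]; apply/pi_eq0.
    by rewrite mul0r rmorph0.
  by rewrite mulrDl -mulrA rmorphD rmorphM Iu Iv mulr0 addr0.
have := @eval_rel_ladder _ _ kappa N s' _ r (pi 'X_[k]) lad.
rewrite -sg -gE -pi_eval_rel -rmorphM /= => /(_ ntr).
rewrite take0 -[eval_rel _ _ _ _]subr0 -rE => /(_ _)/wrap[].
  by apply/pi_eq0; apply: (restrict_congr _ iI).
rewrite gE sg take_size => /foldl_ideal_add0.
pose J x := exists2 f : S, forall k', (mdeg k' <= mdeg k)%N ->
  f@_k' = 0 & pi f = x.
have iJ : is_ideal J.
  split=> [|b _ _ [f f0 <-] [h h0 <-]].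
    by exists 0; [move=> k' _; rewrite mcoeff0 | rewrite rmorph0].
  have [d <-] := pi_surj b; exists (d * f + h); last by rewrite rmorphD rmorphM.
  move=> k' kk'; rewrite mcoeffD h0 // addr0; apply/eqP; rewrite mcoeff_eq0.
  apply/negP => /msuppM_le/allpairsP[[k1 k2] /= [_ fk2 kE]].
  by move: fk2; rewrite mcoeff_msupp f0 ?eqxx // (leq_trans _ kk')
    // kE mdegD leq_addl.
move=> /(ideal_of_seq_min iJ)[_ /mapP[a sa ->]|f f0].
  have [f f0 <-] := sM a sa; exists (f ^+ (mdeg k).+1);
    last by rewrite rmorphXn.
  by move=> k' kk'; apply: mcoeff_exp_small.
move=> /esym/kernel_congr/Ik/eqP.
by rewrite mcoeffB mcoeffX eqxx f0 // subr0 oner_eq0.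
Qed.

(** The image in Q of the prime generated by the variables outside W. It is a proper prime if I
    restricts to zero on W, which for the squared edge ideal is the case when W is independent. *)
Definition vanishing (W : {set 'I_n}) (x : Q) :=
  exists2 f, pi f = x & restrict W f = 0.

Lemma vanishingP W f : (forall h, I h -> restrict W h = 0) ->
  vanishing W (pi f) <-> restrict W f = 0.
Proof.
move=> IW; split=> [[h /kernel_congr/IW/eqP]|]; last by exists f.
by rewrite rmorphB subr_eq0 => /eqP <-.
Qed.

Lemma vanishing_prime W : (forall h, I h -> restrict W h = 0) ->
  is_prime (vanishing W).
Proof.
move=> IW; split.
- split=> [|b _ _ [f <- f0] [h <- h0]].
    by exists 0; rewrite rmorph0.
  have [d <-] := pi_surj b; exists (d * f + h);
    first by rewrite rmorphD rmorphM.
  by rewrite rmorphD rmorphM /= f0 h0 mulr0 addr0.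
- rewrite -(rmorph1 pi) => /(vanishingP _ IW)/eqP.
  by rewrite rmorph1 oner_eq0.
- move=> u v; have [f <-] := pi_surj u; have [h <-] := pi_surj v.
  rewrite -rmorphM => /(vanishingP _ IW)/eqP; rewrite rmorphM mulf_eq0.
  by case/orP => /eqP E; [left | right]; apply/(vanishingP _ IW).
Qed.

Lemma restrict0 (f : S) : restrict set0 f = (f@_0%MM)%:MP.
Proof.
elim/mpoly_gen_ind: f => [c|p q Ep Eq|i p _].
- by rewrite restrictC mcoeffC eqxx mulr1.
- by rewrite rmorphD /= Ep Eq mcoeffD mpolyCD.
- rewrite rmorphM /= restrictX inE mul0r; apply/esym/eqP; rewrite mpolyC_eq0.
  rewrite mcoeff_eq0; apply/negP => /msuppM_le/allpairsP[[k1 k2] /= [ik1 _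
    /esym/eqP]].
  rewrite mnmD_eq0 => /andP[/eqP k10 _]; move: ik1.
  by rewrite k10 msuppX inE eq_sym mnm1_eq0.
Qed.

Lemma restrictI (U W : {set 'I_n}) (f : S) :
  restrict U (restrict W f) = restrict (U :&: W) f.
Proof.
elim/mpoly_gen_ind: f => [c|p q Ep Eq|i p Ep]; first by rewrite !restrictC.
  by rewrite !rmorphD /= Ep Eq.
rewrite !rmorphM /= Ep; congr (_ * _); rewrite !restrictX inE andbC.
by case: (i \in W); rewrite ?rmorph0 // restrictX.
Qed.

Hypothesis I0 : forall h, I h -> h@_0%MM = 0.

Lemma irrelevantP f : irrelevant (pi f) <-> f@_0%MM = 0.
Proof.
split=> [[h h0 /kernel_congr/I0]|]; last by exists f.
by rewrite mcoeffB h0 => /eqP; rewrite sub0r oppr_eq0 => /eqP.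
Qed.

Lemma irrelevant_maximal : exists2 M : idealr Q,
  maximal_ideal M & forall x, x \in M <-> irrelevant x.
Proof.
have vE x : vanishing set0 x <-> irrelevant x.
  split=> [[f fx]|[f f0 fx]]; last by exists f => //;
    rewrite restrict0 f0 mpolyC0.
  by rewrite restrict0 => /eqP; rewrite mpolyC_eq0 => /eqP; exists f.
have [|iM M1 _] := @vanishing_prime set0.
  by move=> h /I0 h0; rewrite restrict0 h0 mpolyC0.
have [M ME] := ideal_asidealr iM M1; exists M => [N MN x xN|x];
  last by rewrite ME vE.
have [f fx] := pi_surj x; rewrite -{}fx in xN *; apply/ME/vE/irrelevantP.
apply/eqP/negPn/negP => c0.
have : pi f - pi (f - (f@_0%MM)%:MP) \in N.
  apply: rpredB => //; apply/MN/ME/vE/irrelevantP.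
  by rewrite mcoeffB mcoeffC eqxx mulr1 subrr.
rewrite -rmorphB subKr => /(idealMr (pi (f@_0%MM)^-1%:MP)).
by rewrite -rmorphM -mpolyCM mulVf // mpolyC1 rmorph1 idealr1.
Qed.

(** The variables of [w] are set to zero one after another. Each step is strict, since the next
    variable joins the ideal and, [w] having no duplicates, was not there before. *)
Theorem irrelevant_prime_chain (M : idealr Q) (w : seq 'I_n) :
    (forall x, x \in M <-> irrelevant x) -> uniq w ->
    (forall h, I h -> restrict [set i in w] h = 0) ->
  prime_chain M (size w).
Proof.
move=> ME uw Iw; pose W i := [set j in drop i w].
have IW i h : I h -> restrict (W i) h = 0.
  move=> /Iw h0; have -> : W i = W i :&: [set j in w].
    apply/esym/setIidPl/subsetP => j; rewrite !inE; apply: mem_drop.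
  by rewrite -restrictI h0 rmorph0.
apply/prime_chainP; exists (fun i => vanishing (W i)); split=> [i|i lti|x].
- by apply: vanishing_prime; apply: IW.
- split=> [_ [f <- f0]|].
    apply/(vanishingP _ (IW _)).
    have -> : W i.+1 = W i.+1 :&: W i.
      apply/esym/setIidPl/subsetP => j; rewrite !inE -add1n -drop_drop.
      exact: mem_drop.
    by rewrite -restrictI f0 rmorph0.
  case: w uw lti @W IW {Iw} => // j0 w' uw lti W IW H.
  set w := j0 :: w' in uw lti W IW H; pose j := nth j0 w i.
  have dE : drop i w = j :: drop i.+1 w by rewrite (drop_nth j0).
  have jW : j \notin drop i.+1 w.
    by have := drop_uniq i uw; rewrite dE => /= /andP[].
  have : vanishing (W i) (pi 'X_j).
    by apply/H/(vanishingP _ (IW _)); rewrite restrictX inE (negPf jW).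
  move=> /(vanishingP _ (IW _)); rewrite restrictX inE dE mem_head.
  by move=> /(congr1 (mcoeff U_(j)))/eqP; rewrite mcoeffX eqxx mcoeff0 oner_eq0.
- rewrite ME; have -> : W (size w) = set0.
    by apply/setP => j; rewrite !inE drop_size.
  split=> [[f fx]|[f f0 fx]]; last by exists f => //;
    rewrite restrict0 f0 mpolyC0.
  by rewrite restrict0 => /eqP; rewrite mpolyC_eq0 => /eqP; exists f.
Qed.

End PolynomialQuotient.

(** * Squares of edge ideals *)

Section SquaredEdgeIdeal.
Variables (K : fieldType) (n : nat) (e : rel 'I_n).
Notation S := {mpoly K[n]}.

Definition edge_square : idealr S := ideal_mul (edge_ideal K e)
  (edge_ideal K e).

(** The exponents of the monomials in I^2; the two edges may coincide. As I^2 is a monomial ideal,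
    membership can be read off coefficient by coefficient. *)
Definition edge_pair_divides (k : 'X_{1..n}) := exists i j i' j',
  [/\ e i j, e i' j' & (U_(i) + U_(j) + (U_(i') + U_(j')) <= k)%MM].

Lemma edge_ideal_mem i j : e i j -> ('X_i * 'X_j : S) \in edge_ideal K e.
Proof. by move=> eij; apply: mem_ideal_span; exists i, j. Qed.

Lemma edge_square_mem i j i' j' (f : S) : e i j -> e i' j' ->
  f * ('X_i * 'X_j * ('X_i' * 'X_j')) \in edge_square.
Proof.
move=> eij eij'; apply: (idealMl _ (idealr_ideal _)); apply: mem_ideal_span.
exists ('X_i * 'X_j), ('X_i' * 'X_j').
by split=> //; apply: edge_ideal_mem.
Qed.

Lemma edge_square_monomial k : edge_pair_divides k ->
  ('X_[k] : S) \in edge_square.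
Proof.
move=> [i [j [i' [j' [eij eij' le_k]]]]].
by rewrite -(submK le_k) !mpolyXD; apply: edge_square_mem.
Qed.

Lemma edge_ideal_coef (f : S) k : f \in edge_ideal K e -> f@_k != 0 ->
  exists i j, e i j /\ (U_(i) + U_(j) <= k)%MM.
Proof.
pose J (f : S) := forall k, f@_k != 0 -> exists i j, e i j /\
  (U_(i) + U_(j) <= k)%MM.
move=> fI; suff : J f by apply.
apply: (ideal_span_min (J := J)) fI.
  split=> [k'|a u v Ju Jv k']; first by rewrite mcoeff0 eqxx.
  rewrite mcoeffD; have [->|vk _] := eqVneq v@_k' 0; last exact: Jv.
  rewrite addr0 -mcoeff_msupp => /msuppM_le/allpairsP[[k1 k2] /= [_ uk2 ->]].
  rewrite mcoeff_msupp in uk2; have [i [j [eij le_k2]]] := Ju _ uk2.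
  by exists i, j; split=> //; apply: lepm_trans le_k2 (lem_addl _ _).
move=> _ [i [j [eij ->]]] k'; rewrite -mpolyXD mcoeffX.
have [<- _|] := eqVneq (U_(i) + U_(j))%MM k'; last by rewrite eqxx.
by exists i, j; split=> //; apply: lepm_refl.
Qed.

Lemma edge_square_coef (f : S) k : f \in edge_square -> f@_k != 0 ->
  edge_pair_divides k.
Proof.
pose J (f : S) := forall k, f@_k != 0 -> edge_pair_divides k.
move=> fI; suff : J f by apply.
apply: (ideal_span_min (J := J)) fI.
  split=> [k'|a u v Ju Jv k']; first by rewrite mcoeff0 eqxx.
  rewrite mcoeffD; have [->|vk _] := eqVneq v@_k' 0; last exact: Jv.
  rewrite addr0 -mcoeff_msupp => /msuppM_le/allpairsP[[k1 k2] /= [_ uk2 ->]].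
  rewrite mcoeff_msupp in uk2; have [i [j [i' [j' [eij eij' le_k2]]]]] :=
    Ju _ uk2.
  exists i, j, i', j'; split=> //; apply: lepm_trans le_k2 (lem_addl _ _).
move=> _ [a [b [aI bI ->]]] k'; rewrite -mcoeff_msupp.
move=> /msuppM_le/allpairsP[[k1 k2] /= [ak1 bk2 ->]].
rewrite !mcoeff_msupp in ak1 bk2.
have [i [j [eij le1]]] := edge_ideal_coef aI ak1.
have [i' [j' [eij' le2]]] := edge_ideal_coef bI bk2.
exists i, j, i', j'; split=> //; apply/mnm_lepP => v.
by rewrite [leqLHS]mnmDE [leqRHS]mnmDE leq_add //; apply: (mnm_lepP _).
Qed.

Lemma edge_square_coef0 (f : S) k :
  f \in edge_square -> ~ edge_pair_divides k -> f@_k = 0.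
Proof.
by move=> fI nk; apply/eqP; apply: contrapT => /negP/(edge_square_coef fI).
Qed.

Lemma edge_square_coef_small (f : S) k :
  f \in edge_square -> (mdeg k < 4)%N -> f@_k = 0.
Proof.
move=> fI k4; apply: (edge_square_coef0 fI) => -[i [j [i' [j' [_ _ le_k]]]]].
by move: k4; rewrite -(submK le_k) !mdegD !mdeg1; lia.
Qed.

Lemma edge_square_restrict (W : {set 'I_n}) (f : S) :
  {in W &, forall i j, ~~ e i j} -> f \in edge_square -> restrict W f = 0.
Proof.
move=> indep; have iJ : is_ideal (fun f : S => restrict W f = 0).
  split=> [|a u v u0 v0]; first by rewrite rmorph0.
  by rewrite rmorphD rmorphM /= u0 v0 mulr0 addr0.
move=> fI; apply: (ideal_span_min iJ _ fI) => _ [a [b [aI _ ->]]].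
apply: (ideal_mulr _ iJ); apply: (ideal_span_min iJ _ aI) => _ [i [j [eij ->]]].
rewrite rmorphM /= !restrictX; case: ifP => iW; last by rewrite mul0r.
case: ifP => jW; last by rewrite mulr0.
by have := indep i j iW jW; rewrite eij.
Qed.

Lemma mcoeff_mulXl i k (f : S) : ('X_i * f)@_(U_(i) + k) = f@_k.
Proof. by rewrite [_ * f]mulrC mcoeffMX. Qed.

Lemma irrelevant_in_span (Q : comNzRingType) (pi : {rmorphism S -> Q}) x :
  irrelevant pi x -> in_span (fun i => pi 'X_i) x.
Proof.
move=> [f f0 <-]; suff [c fE] : exists c : 'I_n -> S, f = \sum_i c i * 'X_i.
  exists (pi \o c); rewrite {1}fE rmorph_sum.
  by apply: eq_bigr => i _; rewrite rmorphM.
suff : exists c : 'I_n -> S, f - (f@_0%MM)%:MP = \sum_i c i * 'X_i.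
  by rewrite f0 mpolyC0 subr0.
elim/mpoly_gen_ind: f {f0} => [c|p q [c pE] [d qE]|i p _].
- exists (fun=> 0); rewrite mcoeffC eqxx mulr1 subrr big1 // => i _.
  by rewrite mul0r.
- exists (fun i => c i + d i); rewrite mcoeffD mpolyCD opprD addrACA pE qE.
  by rewrite -big_split; apply: eq_bigr => i _; rewrite mulrDl.
- exists (fun j => if j == i then p else 0).
  rewrite -restrict0 rmorphM /= restrictX inE mul0r subr0 (bigD1 i) //= eqxx.
  by rewrite big1 ?addr0 1?mulrC // => j /negPf->; rewrite mul0r.
Qed.

End SquaredEdgeIdeal.

(** * Long regular sequences forced by the even vertices *)

Section NotCohenMacaulay.
Variables (K : fieldType) (t : nat).
Hypothesis t3 : (3 <= t)%N.
Notation S := {mpoly K[t]}.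
Notation I := (edge_square K (@cycle_graph t)).
Notation pi := (@quotient_map S I).

Lemma cycle_graphE (i j : 'I_t) : cycle_graph i j =
  [|| j == i.+1 :> nat, i == j.+1 :> nat,
      (i == 0 :> nat) && (j.+1 == t) | (j == 0 :> nat) && (i.+1 == t)].
Proof.
rewrite /cycle_graph -!val_eqE /=.
have succ (k l : 'I_t) : (l == (k.+1 %% t)%N :> nat) =
    (l == k.+1 :> nat) || (l == 0 :> nat) && (k.+1 == t).
  have := ltn_ord k; rewrite leq_eqVlt => /predU1P[kt|kt].
    rewrite kt modnn eqxx andbT [X in _ = X || _](_ : _ = false) //.
    by apply/negbTE; rewrite neq_ltn ltn_ord.
  by rewrite modn_small // (ltn_eqF kt) andbF orbF.
by rewrite !succ -!orbA; do !bool_congr.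
Qed.

Lemma cm_regular_sequence : cohen_macaulay {ideal_quot I} ->
  exists s, [/\ forall x, x \in s -> irrelevant pi x, regular_sequence s
              & (t./2 <= size s)%N].
Proof.
move=> cm.
have I0 h : h \in I -> h@_0%MM = 0.
  by move=> hI; apply: (edge_square_coef_small hI); rewrite mdeg0.
have [M maxM ME] := irrelevant_maximal (@quotient_map_surj S I)
  (@quotient_map_eq0 S I) I0.
(* The largest of these vertices is at most t - 2, so it is not a neighbour of 0; for odd t the even
   vertex t - 1 is left out. *)
pose w : seq 'I_t := pmap insub [seq i.*2 | i <- iota 0 t./2].
have wE i : (i \in w) = (i./2 < t./2)%N && ~~ odd i.
  rewrite mem_pmap_sub; apply/mapP/idP => [[k kt /= ->]|/andP[i2 oi]].
    by move: kt; rewrite mem_iota doubleK odd_double andbT.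
  by exists i./2; rewrite ?mem_iota // -[LHS]odd_double_half (negPf oi).
have uw : uniq w.
  by apply: pmap_sub_uniq; rewrite map_inj_uniq ?iota_uniq //;
    apply: double_inj.
have sw : size w = t./2.
  rewrite size_pmap_sub -[RHS](size_iota 0) -(size_map double).
  apply/eqP; rewrite -all_count; apply/allP => _ /mapP[k kt ->].
  by move: kt; rewrite mem_iota /=; lia.
have Iw h : h \in I -> restrict [set i in w] h = 0.
  apply: edge_square_restrict => i j; rewrite !inE !wE cycle_graphE.
  by move=> /andP[? ?] /andP[? ?]; lia.
have := irrelevant_prime_chain (@quotient_map_surj S I)
  (@quotient_map_eq0 S I) ME uw Iw.
rewrite sw => /(cohen_macaulay_regular_sequence cm maxM)[s [sM reg ts]].
by exists s; split=> // x /sM/ME.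
Qed.

End NotCohenMacaulay.

(** * Cycles of length other than 5 *)

Section NotCohenMacaulayCases.
Variable K : fieldType.

Lemma not_cm_monomial t (t3 : (3 <= t)%N) (W : {set 'I_t}) (k : 'X_{1..t}) :
    ~ edge_pair_divides (@cycle_graph t) k ->
    (forall j, j \notin W -> edge_pair_divides (@cycle_graph t) (U_(j) + k)) ->
    (#|W| < t./2)%N ->
  ~ cohen_macaulay {ideal_quot (edge_square K (@cycle_graph t))}.
Proof.
move=> nk Wk Wt /(cm_regular_sequence t3)[s [sM reg ts]].
suff : (size s <= #|W|)%N by lia.
apply: (regular_sequence_leq (@quotient_map_surj _ _)
  (@quotient_map_eq0 _ (edge_square K (@cycle_graph t))) (k := k)) sM reg.
  by move=> f fI; apply: edge_square_coef0 nk.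
by move=> j jW; rewrite -mpolyXD; apply/edge_square_monomial/Wk.
Qed.

Lemma not_cm_triangle :
  ~ cohen_macaulay {ideal_quot (edge_square K (@cycle_graph 3))}.
Proof.
apply: (@not_cm_monomial 3 isT set0 [multinom 1%N | i < 3]);
  last by rewrite cards0.
  move=> [i [j [i' [j' [_ _ le_k]]]]].
  have := congr1 mdeg (submK le_k); rewrite !mdegD !mdeg1 => /eqP.
  by rewrite [mdeg [multinom _ | _ < _]]mdegE !big_ord_recl big_ord0 !mnmE; lia.
(* x_j x0 x1 x2 is the product of the two edges at j. *)
move=> j _; exists j, (ordS j), j, (ordS (ordS j)).
have ordSE (i : 'I_3) : ordS (ordS (ordS i)) = i.
  by apply: val_inj; case: i => [[|[|[|]]]].
split; rewrite /cycle_graph ?eqxx ?ordSE ?eqxx ?orbT //.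
apply/mnm_lepP => v; rewrite !mnmDE !mnm1E mnmE.
by case: j v => [[|[|[|//]]] ?] [[|[|[|//]]] ?].
Qed.

Lemma not_cm_large t : (6 <= t)%N -> t != 7 ->
  ~ cohen_macaulay {ideal_quot (edge_square K (@cycle_graph t))}.
Proof.
move=> t6 t7; have t3 : (3 <= t)%N by lia.
(* Consecutive vertices of W must be 2 or 3 apart: then W is independent and every other vertex has
   a neighbour in it. Since d gaps add up to t, exactly 2 + odd t of them have length 3, and w puts
   these first. This needs d >= 2 + odd t, which fails for t = 7. *)
pose w k := minn (3 * k) (k.*2 + 2 + odd t); pose d := (t./2).-1.
pose r : seq 'I_t := pmap insub [seq w k | k <- iota 0 d].
pose W := [set i in r].
have WP (i : 'I_t) : reflect (exists2 k, (k < d)%N & i = w k :> nat) (i \in W).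
  rewrite inE mem_pmap_sub; apply: (iffP mapP) => -[k];
    first by rewrite mem_iota; exists k.
  by exists k; rewrite ?mem_iota.
have wW k : (k < d)%N -> exists2 i, i \in W & i = w k :> nat.
  move=> kd; have wt : (w k < t)%N by rewrite /w /d in kd *; lia.
  by exists (Ordinal wt) => //; apply/WP; exists k.
have W1 (i : 'I_t) : i \in W -> i != 1 :> nat.
  by move=> /WP[k kd ->]; rewrite /w; lia.
have indep : {in W &, forall i j, ~~ cycle_graph i j}.
  move=> i j /WP[k kd ik] /WP[l ld jl]; rewrite cycle_graphE // ik jl /w /d in
    kd ld *.
  by lia.
have dom (j : 'I_t) : j \notin W -> exists2 i, i \in W & cycle_graph j i.
  move=> jW; suff [k kd adj] : exists2 k, (k < d)%N & (j == (w k).+1 :> nat)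
      || (w k == j.+1 :> nat) || (w k == 0)%N && (j.+1 == t).
    have [i iW ik] := wW k kd; exists i => //; rewrite cycle_graphE // ik.
    by move: adj; lia.
  have nj k : (k < d)%N -> j <> w k :> nat by move=> kd jk; case/negP: jW;
    apply/WP; exists k.
  (* Below 5 + 3 * odd t the nearest multiple of 3 dominates j. At this value the neighbour is j +
     1, which is the vertex 0 if the cycle closes there. Beyond it, j - 1 is in W, as j is not. *)
  have jt := ltn_ord j; rewrite /d in nj *.
  have [jl|jl] := ltnP j (5 + 3 * odd t).
    exists ((j.+1) %/ 3)%N; first by lia.
    by have := nj (j.+1 %/ 3)%N; rewrite /w; lia.
  have [jE|jE] := eqVneq (j : nat) (5 + 3 * odd t)%N.
    have [tE|tE] := eqVneq t (6 + 3 * odd t)%N.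
      by exists 0%N; rewrite /w; lia.
    by exists (2 + odd t)%N; rewrite /w; lia.
  exists ((j - 2 - odd t)./2)%N; first by lia.
  by have := nj ((j - 2 - odd t)./2)%N; rewrite /w; lia.
(* After inverting the variables of W, I is generated by all the other variables, and x1 is killed
   by each of them modulo the square. Exponent 2 on W replaces the inversion: each of the two edges
   uses one variable of W, possibly the same one. *)
pose k : 'X_{1..t} :=
  [multinom (if i \in W then 2 else ((i : nat) == 1)%N : nat) | i < t].
have lt1 : (1 < t)%N by lia.
pose v1 := Ordinal lt1; have v1W : v1 \notin W by apply/negP => /W1.
apply: (@not_cm_monomial t t3 W k).
(* An edge dividing the monomial is not contained in W and so passes through vertex 1; two such
   edges would need exponent 2 there. *)
- have out i j : cycle_graph i j -> (forall v, (i == v) + (j == v) <= k v)%N ->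
      i = v1 \/ j = v1.
    move=> ij le_k; have [iW|iW] := boolP (i \in W); last first.
      by left; apply/val_inj/eqP; have := le_k i;
        rewrite mnmE (negPf iW) eqxx /=; case: (nat_of_ord i == 1)%N.
    have jW : j \notin W by apply/negP => jW; have := indep i j iW jW;
      rewrite ij.
    by right; apply/val_inj/eqP; have := le_k j;
      rewrite mnmE (negPf jW) eqxx addn1 /=; case: (nat_of_ord j == 1)%N.
  move=> [i [j [i' [j' [ij ij' /mnm_lepP le_k]]]]].
  have le_k' v : ((i == v) + (j == v) + ((i' == v) + (j' == v)) <= k v)%N.
    by have := le_k v; rewrite !mnmDE !mnm1E.
  have le1 : (2 <= k v1)%N.
    apply: leq_trans (le_k' v1).
    have Eij : i = v1 \/ j = v1.
      by apply: out => // v; apply: leq_trans (le_k' v); rewrite leq_addr.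
    have Eij' : i' = v1 \/ j' = v1.
      by apply: out => // v; apply: leq_trans (le_k' v); rewrite leq_addl.
    by case: Eij Eij' => -> [] ->; rewrite eqxx; lia.
  by rewrite mnmE (negPf v1W) in le1.
- move=> j jW; have [i iW ji] := dom j jW; have [i' iW' ji'] := dom v1 v1W.
  exists j, i, v1, i'; split=> //; apply/mnm_lepP => v.
  rewrite !mnmDE !mnm1E mnmE; case: ifPn => vW.
    have -> : (v1 == v) = false by apply/negbTE; apply: contraNneq v1W => ->.
    by case: (j == v); case: (i == v); case: (i' == v).
  have -> : (i == v) = false by apply/negbTE; apply: contraNneq vW => <-.
  have -> : (i' == v) = false by apply/negbTE; apply: contraNneq vW => <-.
  have -> : (v1 == v) = (v == 1 :> nat) by rewrite -val_eqE eq_sym.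
  by rewrite !addn0.
- have Wr : (#|W| <= size r)%N by rewrite cardsE card_size.
  have rd : (size r <= d)%N.
    by rewrite size_pmap_sub (leq_trans (count_size _ _)) // size_map size_iota.
  by apply: leq_ltn_trans Wr (leq_ltn_trans rd _); rewrite /d; lia.
Qed.

(* The ideal is (x0, x2)^2 (x1, x3)^2.  The cocycle is multiplication by the
   element of the product of the two primary quotients whose components are
   x0 x1 and 0. *)
Lemma not_cm_square :
  ~ cohen_macaulay {ideal_quot (edge_square K (@cycle_graph 4))}.
Proof.
move=> /(cm_regular_sequence (isT : 3 <= 4)%N)[[|g1 [|g2 s]] [sM reg] // _].
set I := edge_square _ _ in sM reg *; pose pi := @quotient_map _ I.
pose X (i : nat) : {mpoly K[4]} := 'X_(inord i).
have sp g : g \in [:: g1, g2 & s] -> in_span (fun i => pi 'X_i) g.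
  by move=> /sM; apply: irrelevant_in_span.
have reg2 : weakly_regular (fun x => x = 0) [:: g1; g2].
  by have [? [? _]] := regular_weakly reg.
have i0 : is_ideal (fun x : {ideal_quot I} => x = 0).
  by split=> // b u v -> ->; rewrite mulr0 addr0.
(* x0 x1 x_i lies in (x1, x3)^2 for odd i, so it lifts the pair with components x0 x1 x_i and 0; for
   even i it lies in (x0, x2)^2, so the pair is zero. *)
pose F (i : 'I_4) : {mpoly K[4]} := (odd i)%:R * (X 0%N * X 1%N * 'X_i).
have odd_edge (i j : 'I_4) : odd i -> ~~ odd j -> cycle_graph i j.
  by case: i j => [[|[|[|[|//]]]] ?] [[|[|[|[|//]]]] ?].
have [||i j|r fr] := koszul_exact1 i0 _ _ reg2 (f := pi \o F) (z :=
  fun i => pi 'X_i).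
- by apply: sp; rewrite inE eqxx.
- by apply: sp; rewrite !inE eqxx orbT.
- rewrite /= -!rmorphM -rmorphB; apply/quotient_map_eq0; rewrite /F.
  have mem (a b : 'I_4) : odd a -> ~~ odd b ->
      'X_b * (X 0%N * X 1%N * 'X_a) \in I.
    move=> oa ob; rewrite (_ : _ * _ = 1 * ('X_(inord 1)
      * 'X_b * ('X_a * 'X_(inord 0)))).
      by apply: edge_square_mem; apply: odd_edge; rewrite ?inordK.
    by rewrite /X; ring.
  case: (boolP (odd i)) (boolP (odd j)) => oi [] oj;
    rewrite ?mul1r ?mul0r ?mulr0 ?subr0 ?sub0r ?rpredN.
  + rewrite (_ : _ - _ = 0) ?rpred0 //; ring.
  + exact: mem.
  + exact: mem.
  + exact: rpred0.
have [rho rhoE] := quotient_map_surj r.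
have coefF (i : 'I_4) k : (mdeg k < 4)%N -> (F i)@_k = ('X_i * rho)@_k.
  move=> k4; apply/eqP; rewrite -subr_eq0 -mcoeffB; apply/eqP.
  have FI : F i - 'X_i * rho \in I.
    by apply/quotient_map_eq0; have := fr i; rewrite -rhoE /= -rmorphM -rmorphB.
  exact: edge_square_coef_small FI k4.
(* The component at x0 forces coefficient 0 of x0 x1 in rho, the component at x1 forces 1. Both
   comparisons happen in degree 3, where I^2 is zero. *)
pose k0 : 'X_{1..4} := (U_(inord 0) + U_(inord 1))%MM.
have := coefF (inord 0) (U_(inord 0) + k0)%MM.
rewrite mcoeff_mulXl /F inordK // mul0r mcoeff0 !mdegD !mdeg1 => /(_ isT) rho0.
have := coefF (inord 1) (U_(inord 1) + k0)%MM.
rewrite mcoeff_mulXl /F inordK // mul1r mulrC mcoeff_mulXl -rho0 !mdegD !mdeg1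
  => /(_ isT)/eqP.
by rewrite -mpolyXD mcoeffX eqxx oner_eq0.
Qed.

End NotCohenMacaulayCases.

(** * The heptagon *)

Section NotCohenMacaulayHeptagon.
Variable K : fieldType.

Local Open Scope nat_scope.

Definition adj7 i j := (j == i.+1 %% 7) || (i == j.+1 %% 7).

Definition heptagon_cochain i j : nat := (i == 0) && ((j == 3) || (j == 5)).

(** The cocycle condition for the antisymmetrized cochain, with negative terms moved to the other
    side to stay in [nat]. It may fail where x_i x_j x_k x3 x4 is in I^2: either two of i, j, k form
    an edge, to be paired with the edge 34, or one of them is adjacent to 3 and another to 4. *)
Lemma heptagon_cocycle : all (fun i => all (fun j => all (fun k =>
  [|| heptagon_cochain i j + heptagon_cochain j k + heptagon_cochain k i
       == heptagon_cochain j i + heptagon_cochain k j + heptagon_cochain i k,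
      adj7 i j, adj7 j k, adj7 i k,
      adj7 i 3 && adj7 j 4, adj7 i 3 && adj7 k 4, adj7 j 3 && adj7 i 4,
      adj7 j 3 && adj7 k 4, adj7 k 3 && adj7 i 4 | adj7 k 3 && adj7 j 4])
  (iota 0 7)) (iota 0 7)) (iota 0 7).
Proof. by vm_compute. Qed.

(** The pairs are the steps of the closed path 0, 3, 6, 4, 0. In these degrees nothing is lost
    modulo I^2, so a coboundary sums to zero along the path, whereas the cochain gives 1. *)
Lemma heptagon_nonzero : all (fun p => all (fun i => all (fun j =>
    all (fun i' => all (fun j' => adj7 i j && adj7 i' j' ==>
      ~~ all (fun v => (i == v) + (j == v) + ((i' == v) + (j' == v)) <=
                       (p.1 == v) + ((p.2 == v) + ((3 == v) + (4 == v))))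
             (iota 0 7))
    (iota 0 7)) (iota 0 7)) (iota 0 7)) (iota 0 7))
  [:: (0, 3); (3, 6); (4, 6); (0, 4)].
Proof. by vm_compute. Qed.

Local Close Scope nat_scope.

(* After inverting x0 the ideal is the square of (x1, x6) + the edge ideal of
   the path 2, 3, 4, 5, whose H^1 in the degree of x3 x4 does not vanish; the
   cochain is the connecting image of the corresponding class. *)
Lemma not_cm_heptagon :
  ~ cohen_macaulay {ideal_quot (edge_square K (@cycle_graph 7))}.
Proof.
move=> /(cm_regular_sequence (isT : 3 <= 7)%N)[[|g1 [|g2 [|g3 s]]] [sM reg] //
  _].
set I := edge_square _ _ in sM reg *; pose pi := @quotient_map _ I.
have sp g : g \in [:: g1, g2, g3 & s] -> in_span (fun i => pi 'X_i) g.
  by move=> /sM; apply: irrelevant_in_span.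
have reg3 : weakly_regular (fun x => x = 0) [:: g1; g2; g3].
  by have [? [? [? _]]] := regular_weakly reg.
have i0 : is_ideal (fun x : {ideal_quot I} => x = 0).
  by split=> // b u v -> ->; rewrite mulr0 addr0.
pose c (i j : nat) : K := (heptagon_cochain i j)%:R - (heptagon_cochain j i)%:R.
have cE i j : c i j = (heptagon_cochain i j)%:R - (heptagon_cochain j i)%:R by
  [].
clearbody c.
pose X34 : {mpoly K[7]} := 'X_(inord 3) * 'X_(inord 4).
pose H (i j : 'I_7) := (c i j)%:MP * ('X_i * ('X_j * X34)).
have adjE (i j : 'I_7) : adj7 i j -> cycle_graph i j.
  by rewrite /cycle_graph -!val_eqE.
have adj_ord (i : 'I_7) b : (b < 7)%N -> adj7 i b -> cycle_graph i (inord b).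
  by move=> b7 ib; apply: adjE; rewrite inordK.
have io7 (i : 'I_7) : (i : nat) \in iota 0 7 by rewrite mem_iota ltn_ord.
have mem (f : {mpoly K[7]}) i j i' j' p : cycle_graph i j ->
  cycle_graph i' j' ->
    p = f * ('X_i * 'X_j * ('X_i' * 'X_j')) -> p \in I.
  by move=> ij ij' ->; apply: edge_square_mem.
have e34 : cycle_graph (inord 3 : 'I_7) (inord 4) by apply: adjE;
  rewrite !inordK.
have Hcycle i j k : 'X_k * H i j - 'X_j * H i k + 'X_i * H j k \in I.
  have -> : 'X_k * H i j - 'X_j * H i k + 'X_i * H j k =
      (c i j - c i k + c j k)%:MP * ('X_i * 'X_j * 'X_k * X34).
    by rewrite /H mpolyCD mpolyCB; ring.
  have /allP/(_ _ (io7 i))/allP/(_ _ (io7 j))/allP/(_ _ (io7 k)) :=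
    heptagon_cocycle.
  case/predU1P => [E|].
    rewrite (_ : c i j - c i k + c j k = 0) ?mpolyC0 ?mul0r ?rpred0 //.
    have -> : c i j - c i k + c j k =
      (heptagon_cochain i j + heptagon_cochain j k + heptagon_cochain k i)%N%:R
      - (heptagon_cochain j i + heptagon_cochain k j + heptagon_cochain i
          k)%N%:R.
      by rewrite !natrD !cE; ring.
    by rewrite E subrr.
  rewrite /X34; set d := (_)%:MP.
  case/orP => [/adjE ij|]; first by apply: (mem (d * 'X_k) _ _ _ _ _ ij e34);
    ring.
  case/orP => [/adjE ij|]; first by apply: (mem (d * 'X_i) _ _ _ _ _ ij e34);
    ring.
  case/orP => [/adjE ij|]; first by apply: (mem (d * 'X_j) _ _ _ _ _ ij e34);
    ring.
  have mem34 (x y : 'I_7) : adj7 x 3 && adj7 y 4 -> forall z p,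
      p = d * ('X_x * 'X_y * 'X_z * X34) -> p \in I.
    case/andP => /(adj_ord _ 3%N isT) x3 /(adj_ord _ 4%N isT) y4 z p ->.
    by apply: (mem (d * 'X_z) _ _ _ _ _ x3 y4); rewrite /X34; ring.
  case/or4P => [/mem34 m34|/mem34 m34|/mem34 m34|].
  - by apply: (m34 k); rewrite /X34; ring.
  - by apply: (m34 j); rewrite /X34; ring.
  - by apply: (m34 k); rewrite /X34; ring.
  case/or3P => /mem34 m34.
  - by apply: (m34 i); rewrite /X34; ring.
  - by apply: (m34 j); rewrite /X34; ring.
  - by apply: (m34 i); rewrite /X34; ring.
have [|||i j k|r Hr] := koszul_exact2 i0 _ _ _ reg3
    (h := fun i j => pi (H i j)) (z := fun i => pi 'X_i).
- by apply: sp; rewrite inE eqxx.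
- by apply: sp; rewrite !inE eqxx orbT.
- by apply: sp; rewrite !inE eqxx !orbT.
- by rewrite -!rmorphM -rmorphB -rmorphD; apply/quotient_map_eq0; apply: Hcycle.
have [rho rhoE] := choice (fun i => quotient_map_surj (r i)).
pose k0 : 'X_{1..7} := (U_(inord 3) + U_(inord 4))%MM.
have XE : X34 = 'X_[k0] by rewrite mpolyXD.
(* The component of a primitive that matters: in degree x_i x_j x3 x4 the coboundary equation reads
   c_ij = mu_i - mu_j. *)
pose mu i := (rho i)@_(U_(i) + k0).
have coefE (i j : nat) : (i, j) \in [:: (0, 3); (3, 6); (4, 6); (0, 4)]%N ->
    c i j = mu (inord i) - mu (inord j).
  move=> ijP; have [i7 j7] : (i < 7 /\ j < 7)%N.
    by move: ijP; rewrite !inE => /or4P[] /eqP[-> ->].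
  set i' := inord i; set j' := inord j.
  have HI : H i' j' - ('X_j' * rho i' - 'X_i' * rho j') \in I.
    by apply/quotient_map_eq0; have := Hr i' j';
      rewrite -!rhoE -!rmorphM -!rmorphB.
  have nz : ~ edge_pair_divides (@cycle_graph 7) (U_(i') + (U_(j') + k0)).
    move=> [a [b [a' [b' [ab ab' /mnm_lepP le_k]]]]].
    have := heptagon_nonzero; move=> /allP/(_ _ ijP)/allP/(_ _ (io7 a))/allP/(_
      _ (io7 b)).
    move=> /allP/(_ _ (io7 a'))/allP/(_ _ (io7 b'))/implyP.
    have adjN (x y : 'I_7) : cycle_graph x y ->
      adj7 x y by rewrite /cycle_graph -!val_eqE.
    rewrite (adjN _ _ ab) (adjN _ _ ab') => /(_ isT)/negP; apply;
      apply/allP => v.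
    rewrite mem_iota => v7; have := le_k (Ordinal (v7 : (v < 7)%N)).
    by rewrite !mnmDE !mnm1E -!val_eqE /= !inordK.
  have sw : (U_(i') + (U_(j') + k0) = U_(j') + (U_(i') + k0))%MM.
    by rewrite !addmA [(U_(i') + _)%MM]addmC.
  have := edge_square_coef0 HI nz; rewrite !mcoeffB {2}sw !mcoeff_mulXl.
  rewrite /H XE -!mpolyXD mcoeffCM mcoeffX eqxx mulr1 /i' /j' !inordK //.
  by move=> /eqP; rewrite subr_eq0 => /eqP.
have c03 := coefE 0%N 3%N isT; have c36 := coefE 3%N 6%N isT.
have c46 := coefE 4%N 6%N isT; have c04 := coefE 0%N 4%N isT.
have : c 0%N 3%N + c 3%N 6%N - c 4%N 6%N - c 0%N 4%N = 0.
  by rewrite c03 c36 c46 c04; ring.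
by move/eqP; rewrite !cE /= !subr0 !addr0 oner_eq0.
Qed.

End NotCohenMacaulayHeptagon.

(** * Bivariate polynomials *)

Section BivariatePolynomials.
Variable K : fieldType.
Implicit Types (p q : {poly K}) (f c d e : {poly {poly K}}).

(* Divide the coefficients of c by p; the leading coefficient of the remainder
   times that of f is a coefficient of a multiple of p. *)
Lemma polyC_dvd p f c d e : coprimep p (lead_coef f) -> p != 0 ->
  (size e < size f)%N -> f * c = p%:P * d + e -> exists c1, c = p%:P * c1.
Proof.
move=> cop p0 sef fc; pose c1 := \poly_(i < size c) (c`_i %/ p).
pose c2 := c - p%:P * c1; exists c1; apply/eqP; rewrite -subr_eq0 -/c2.
apply: contraT => c20.
have c2E i : c2`_i = c`_i %% p.
  rewrite coefB coefCM coef_poly; case: ltnP => [_|ci].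
    by rewrite {1}(divp_eq c`_i p) mulrC addrC addKr.
  by rewrite nth_default // mulr0 subr0 mod0p.
have fc2 : f * c2 = p%:P * (d - f * c1) + e.
  by rewrite mulrBr fc; ring.
have f0 : f != 0 by rewrite -size_poly_eq0 -lt0n; apply: leq_ltn_trans sef.
have sc2 : (0 < size c2)%N by rewrite lt0n size_poly_eq0.
have : p %| lead_coef c2.
  rewrite -(Gauss_dvdpr _ cop) -lead_coefM lead_coefE; set n := (size _).-1.
  have ne : (size e <= n)%N.
    rewrite /n size_mul //; move: sef sc2; case: (size f) => // l;
      case: (size c2) => // m.
    by rewrite addSn addnS /= ltnS => el _; rewrite (leq_trans el) ?leq_addr.
  by rewrite fc2 coefD coefCM [e`__]nth_default // addr0 dvdp_mulr.
rewrite lead_coefE c2E => /dvdp_leq; rewrite -c2E -lead_coefE lead_coef_eq0.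
by move=> /(_ c20); rewrite lead_coefE c2E leqNgt ltn_modp p0.
Qed.

Variables (R : comNzRingType) (kappa : {rmorphism K -> R}) (M : idealr R).
Hypothesis maxM : maximal_ideal M.

Definition eval2 (u v : R) : {poly {poly K}} -> R :=
  horner_eval v \o map_poly (horner_eval u \o map_poly kappa).

HB.instance Definition _ u v := GRing.RMorphism.on (eval2 u v).

Lemma eval2C u v p : eval2 u v p%:P = (map_poly kappa p).[u].
Proof. by rewrite /eval2 /= map_polyC /horner_eval hornerC. Qed.

Lemma eval2X u v : eval2 u v 'X = v.
Proof. by rewrite /eval2 /= map_polyX /horner_eval hornerX. Qed.

Lemma eval2CX u v : eval2 u v 'X%:P = u.
Proof. by rewrite eval2C map_polyX hornerX. Qed.

Lemma eval2CC u v (x : K) : eval2 u v x%:P%:P = kappa x.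
Proof. by rewrite eval2C map_polyC hornerC. Qed.

(* If no nonzero q(u) lies in M, pick f in M of least degree in v, with leading
   coefficient a, and invert 1 + u a modulo M: pseudo-division by f shows that f
   divides a power of a modulo 1 + u a, where a is a unit. *)
Lemma maximal_meets_line u v : (forall s, exists f, s - eval2 u v f \in M) ->
  exists2 q, q != 0 & (map_poly kappa q).[u] \in M.
Proof.
move=> gen; apply: contrapT => noq.
pose Z f := eval2 u v f \in M.
have Zq q : Z q%:P -> q = 0.
  move=> Zq; apply/eqP; apply: contraT => q0; case: noq; exists q => //.
  by rewrite -(eval2C u v).
have inv q : q != 0 -> exists b, Z (b * q%:P - 1).
  move=> q0; have qM : eval2 u v q%:P \notin M.
    by apply: contra_neqN q0 => /Zq.
  have [s sM] := maximal_inv maxM qM; have [b bM] := gen s; exists b.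
  rewrite /Z rmorphB rmorphM rmorph1.
  rewrite (_ : _ - 1 = (s * eval2 u v q%:P - 1)
    - eval2 u v q%:P * (s - eval2 u v b)).
    by rewrite rpredB // idealMr.
  by ring.
have exf : exists n, `[< exists f, [/\ f != 0, Z f & size f = n] >].
  have [|b Zb] := inv 'X; first by rewrite polyX_eq0.
  exists (size (b * 'X%:P - 1)); apply/asboolP; exists (b * 'X%:P - 1);
    split=> //.
  apply/eqP => /(congr1 (fun f : {poly {poly K}} => (f`_0).[0])).
  rewrite coefB coefMC coef1 coef0 !hornerE /= => /eqP.
  by rewrite ?mulr0 ?sub0r oppr_eq0 oner_eq0.
case: (ex_minnP exf) => n /asboolP[f [f0 Zf fn]] minf.
have {}minf g : Z g -> (size g < size f)%N -> g = 0.
  move=> Zg gf; apply/eqP; apply: contraT => g0; rewrite ltnNge fn in gf.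
  by case/negP: gf; apply: minf; apply/asboolP; exists g.
have sf : (1 < size f)%N.
  rewrite ltnNge; apply: contra_neqN f0 => /size1_polyC fE.
  by rewrite fE (Zq f`_0) ?polyC0 // -fE.
pose a := lead_coef f; have a0 : a != 0 by rewrite lead_coef_eq0.
(* Coprime to a and of positive degree even when a is constant, so q cannot divide a power of a. *)
pose q := 1 + 'X * a.
have cop : coprimep q a.
  by rewrite coprimep_sym /q addrC coprimep_addl_mul coprimep1.
have sq : (1 < size q)%N.
  have sXa : size ('X * a) = (size a).+1 by rewrite mulrC size_mulX.
  have a1 : (0 < size a)%N by rewrite lt0n size_poly_eq0.
  by rewrite /q addrC size_polyDl sXa ?size_poly1.
have q0 : q != 0 by rewrite -size_poly_eq0 -lt0n ltnW.
have [b Zb] := inv q q0.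
pose g := b * q%:P - 1; pose k := scalp g f.
have eqg := Pdiv.Idomain.divp_eq g f; rewrite -/k -/a in eqg.
have mod0 : g %% f = 0.
  apply: minf; last by rewrite Pdiv.Idomain.ltn_modpN0.
  have -> : g %% f = a ^+ k *: g - g %/ f * f by rewrite eqg addrC addKr.
  rewrite /Z rmorphB -mul_polyC !rmorphM /=; apply: rpredB.
    by rewrite idealMr.
  by rewrite idealMr.
pose A := (a ^+ k)%:P.
(* Minimality of f made the remainder zero. By [polyC_dvd] q divides the quotient, hence the
   right-hand side shows that q divides a^k. *)
have fg : f * (g %/ f) = q%:P * (b * A) - A.
  transitivity (a ^+ k *: g); first by rewrite eqg mod0 addr0 mulrC.
  by rewrite -mul_polyC -/A mulrBr mulr1 [A * _]mulrC mulrAC [_ * q%:P]mulrC.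
have [|h1 hE] := polyC_dvd cop q0 _ fg.
  by rewrite size_polyN (leq_ltn_trans (size_polyC_leq1 _)).
have : q %| a ^+ k.
  have AE : A = q%:P * (b * A - h1 * f).
    by rewrite mulrBr [h1 * f]mulrC [q%:P * (f * h1)]mulrCA -hE fg opprB addrC
      subrK.
  have := congr1 (fun f => f`_0) AE; rewrite coefCM coefC /= => ->.
  exact: dvdp_mulr.
have : coprimep q (a ^+ k) by rewrite coprimep_expr.
move=> /coprimepP copk /copk; rewrite dvdpp => /(_ isT)/eqp_size.
by rewrite size_poly1 => sq1; rewrite sq1 in sq.
Qed.

End BivariatePolynomials.

(** * The pentagon *)

Section QuarticReduction.
Variables (B : comNzRingType) (a b c t1 t2 : B) (V : B -> Prop).

Definition mon3 i j k := a ^+ i * b ^+ j * c ^+ k.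

Hypothesis VD : forall x y, V x -> V y -> V (x + y).
Hypothesis VN : forall x, V x -> V (- x).
Hypothesis V1 : forall x, V x -> V (t1 * x).
Hypothesis V2 : forall x, V x -> V (t2 * x).
Hypothesis Vmon : forall i j k, (i + j + k <= 3)%N -> V (mon3 i j k).

Let r1 := a ^+ 2 - t1 * a.
Let r2 := a * c.
Let r3 := a * b + b * c - t1 * b.
Let r4 := b ^+ 2 + b * c - t2 * b.
Let r5 := c ^+ 2 + b * c - t2 * c.

Hypothesis Vr : {in [:: r1; r2; r3; r4; r5] &, forall x y, V (x * y)}.

Local Ltac V_closed := repeat first
  [ apply: VD | apply: VN | apply: V1 | apply: V2 | exact: Vmon | assumption ].

(* The leading forms of the products r_i r_j are a basis of the quartic forms
   over the integers; the coefficients come from inverting that matrix. *)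
Lemma quartic_reduction i j k : (i + j + k)%N = 4 -> V (mon3 i j k).
Proof.
have V11 : V (r1 * r1) by apply: Vr; rewrite !inE eqxx ?orbT.
have V12 : V (r1 * r2) by apply: Vr; rewrite !inE eqxx ?orbT.
have V13 : V (r1 * r3) by apply: Vr; rewrite !inE eqxx ?orbT.
have V14 : V (r1 * r4) by apply: Vr; rewrite !inE eqxx ?orbT.
have V15 : V (r1 * r5) by apply: Vr; rewrite !inE eqxx ?orbT.
have V22 : V (r2 * r2) by apply: Vr; rewrite !inE eqxx ?orbT.
have V23 : V (r2 * r3) by apply: Vr; rewrite !inE eqxx ?orbT.
have V24 : V (r2 * r4) by apply: Vr; rewrite !inE eqxx ?orbT.
have V25 : V (r2 * r5) by apply: Vr; rewrite !inE eqxx ?orbT.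
have V33 : V (r3 * r3) by apply: Vr; rewrite !inE eqxx ?orbT.
have V34 : V (r3 * r4) by apply: Vr; rewrite !inE eqxx ?orbT.
have V35 : V (r3 * r5) by apply: Vr; rewrite !inE eqxx ?orbT.
have V44 : V (r4 * r4) by apply: Vr; rewrite !inE eqxx ?orbT.
have V45 : V (r4 * r5) by apply: Vr; rewrite !inE eqxx ?orbT.
have V55 : V (r5 * r5) by apply: Vr; rewrite !inE eqxx ?orbT.
move: i j k => [|[|[|[|[|i]]]]] [|[|[|[|[|j]]]]] [|[|[|[|[|k]]]]] //;
  rewrite ?addSn ?addnS ?addn0 //= => _; clear Vr.
- rewrite (_ : mon3 0 0 4 = r2 * r2 + r2 * r3 + r2 * r3 + r3 * r3 + r5 * r5 +
    t1 * (mon3 1 2 0) + t1 * (t2 * (mon3 1 1 0)) + t1 * (t2 * (mon3 1 0 1)) +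
    t1 * (t2 * (mon3 0 1 1)) + t1 * (t2 * (mon3 0 1 1)) + t2 * (mon3 0 0 3) +
    t2 * (mon3 0 0 3) - r1 * r4 - r1 * r5 - r3 * r5 - r3 * r5 - t2 * (mon3 2 1
    0) - t2 * (mon3 2 0 1) - t1 * (mon3 1 0 2) - t1 * (t1 * (mon3 0 2 0)) - t2
    * (mon3 1 1 1) - t2 * (mon3 1 1 1) - t1 * (mon3 0 1 2) - t1 * (mon3 0 1 2)
    - t2 * (t2 * (mon3 0 0 2))); last by rewrite /r1 /r2 /r3 /r4 /r5 /mon3;
    ring.
  by V_closed.
- rewrite (_ : mon3 0 1 3 = r1 * r4 + r1 * r5 + r2 * r4 + r3 * r5 + t2 * (mon3
    2 1 0) + t2 * (mon3 2 0 1) + t1 * (mon3 1 0 2) + t2 * (mon3 1 1 1) + t2 *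
    (mon3 1 1 1) + t1 * (t1 * (mon3 0 2 0)) + t2 * (mon3 0 1 2) + t1 * (mon3 0
    1 2) - r2 * r2 - r2 * r3 - r2 * r3 - r3 * r3 - t1 * (mon3 1 2 0) - t1 *
    (t2 * (mon3 1 1 0)) - t1 * (t2 * (mon3 1 0 1)) - t1 * (mon3 0 2 1) - t1 *
    (t2 * (mon3 0 1 1))); last by rewrite /r1 /r2 /r3 /r4 /r5 /mon3; ring.
  by V_closed.
- rewrite (_ : mon3 0 2 2 = r2 * r2 + r2 * r3 + r2 * r3 + r3 * r3 + t1 * (mon3
    1 2 0) + t1 * (t2 * (mon3 1 1 0)) + t1 * (t2 * (mon3 1 0 1)) + t1 * (mon3
    0 2 1) + t1 * (mon3 0 2 1) - r1 * r4 - r1 * r5 - r2 * r4 - r2 * r4 - t2 *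
    (mon3 2 1 0) - t2 * (mon3 2 0 1) - t1 * (mon3 1 0 2) - t2 * (mon3 1 1 1) -
    t2 * (mon3 1 1 1) - t1 * (t1 * (mon3 0 2 0))); last by rewrite /r1 /r2 /r3
    /r4 /r5 /mon3; ring.
  by V_closed.
- rewrite (_ : mon3 0 3 1 = r1 * r4 + r1 * r5 + r2 * r4 + r2 * r4 + r2 * r4 +
    r4 * r5 + t2 * (mon3 2 1 0) + t2 * (mon3 2 0 1) + t1 * (mon3 1 0 2) + t2 *
    (mon3 1 1 1) + t2 * (mon3 1 1 1) + t1 * (t1 * (mon3 0 2 0)) + t2 * (mon3 0
    1 2) + t1 * (t2 * (mon3 0 1 1)) + t2 * (mon3 0 2 1) + t2 * (mon3 0 2 1) -
    r2 * r2 - r2 * r3 - r2 * r3 - r3 * r3 - r3 * r5 - t1 * (mon3 1 2 0) - t1 *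
    (t2 * (mon3 1 1 0)) - t1 * (t2 * (mon3 1 0 1)) - t1 * (mon3 0 2 1) - t1 *
    (mon3 0 2 1) - t1 * (mon3 0 2 1) - t1 * (mon3 0 1 2) - t2 * (t2 * (mon3 0
    1 1))); last by rewrite /r1 /r2 /r3 /r4 /r5 /mon3; ring.
  by V_closed.
- rewrite (_ : mon3 0 4 0 = r2 * r2 + r2 * r3 + r2 * r3 + r3 * r3 + r3 * r5 +
    r3 * r5 + r4 * r4 + t1 * (mon3 1 2 0) + t1 * (t2 * (mon3 1 1 0)) + t1 *
    (t2 * (mon3 1 0 1)) + t1 * (mon3 0 2 1) + t1 * (mon3 0 2 1) + t1 * (mon3 0
    2 1) + t1 * (mon3 0 2 1) + t1 * (mon3 0 1 2) + t1 * (mon3 0 1 2) + t2 *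
    (mon3 0 3 0) + t2 * (mon3 0 3 0) + t2 * (t2 * (mon3 0 1 1)) + t2 * (t2 *
    (mon3 0 1 1)) - r1 * r4 - r1 * r5 - r2 * r4 - r2 * r4 - r2 * r4 - r2 * r4
    - r4 * r5 - r4 * r5 - t2 * (mon3 2 1 0) - t2 * (mon3 2 0 1) - t1 * (mon3 1
    0 2) - t2 * (mon3 1 1 1) - t2 * (mon3 1 1 1) - t1 * (t1 * (mon3 0 2 0)) -
    t2 * (mon3 0 1 2) - t2 * (mon3 0 1 2) - t1 * (t2 * (mon3 0 1 1)) - t1 *
    (t2 * (mon3 0 1 1)) - t2 * (mon3 0 2 1) - t2 * (mon3 0 2 1) - t2 * (t2 *
    (mon3 0 2 0))); last by rewrite /r1 /r2 /r3 /r4 /r5 /mon3; ring.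
  by V_closed.
- rewrite (_ : mon3 1 0 3 = r1 * r5 + r2 * r5 + t2 * (mon3 2 0 1) + t1 * (mon3
    1 0 2) + t2 * (mon3 1 0 2) - r2 * r2 - r2 * r3 - t1 * (t2 * (mon3 1 0
    1))); last by rewrite /r1 /r2 /r3 /r4 /r5 /mon3; ring.
  by V_closed.
- rewrite (_ : mon3 1 1 2 = r2 * r2 + r2 * r3 + t1 * (t2 * (mon3 1 0 1)) - r1
    * r5 - t2 * (mon3 2 0 1) - t1 * (mon3 1 0 2)); last by rewrite /r1 /r2 /r3
    /r4 /r5 /mon3; ring.
  by V_closed.
- rewrite (_ : mon3 1 2 1 = r1 * r5 + r2 * r4 + t2 * (mon3 2 0 1) + t1 * (mon3
    1 0 2) + t2 * (mon3 1 1 1) - r2 * r2 - r2 * r3 - t1 * (t2 * (mon3 1 0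
    1))); last by rewrite /r1 /r2 /r3 /r4 /r5 /mon3; ring.
  by V_closed.
- rewrite (_ : mon3 1 3 0 = r2 * r2 + r2 * r3 + r3 * r4 + r3 * r5 + t1 * (t2 *
    (mon3 1 0 1)) + t2 * (mon3 1 2 0) + t1 * (mon3 0 3 0) + t1 * (mon3 0 2 1)
    + t1 * (mon3 0 2 1) + t1 * (mon3 0 1 2) + t2 * (t2 * (mon3 0 1 1)) - r1 *
    r5 - r2 * r4 - r2 * r4 - r4 * r5 - t2 * (mon3 2 0 1) - t1 * (mon3 1 0 2) -
    t2 * (mon3 1 1 1) - t2 * (mon3 0 2 1) - t1 * (t2 * (mon3 0 2 0)) - t2 *
    (mon3 0 1 2) - t1 * (t2 * (mon3 0 1 1))); last by rewrite /r1 /r2 /r3 /r4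
    /r5 /mon3; ring.
  by V_closed.
- rewrite (_ : mon3 2 0 2 = r2 * r2); last by rewrite /r1 /r2 /r3 /r4 /r5
    /mon3; ring.
  by V_closed.
- rewrite (_ : mon3 2 1 1 = r1 * r5 + t2 * (mon3 2 0 1) + t1 * (mon3 1 0 2) +
    t1 * (mon3 1 1 1) - r2 * r2 - t1 * (t2 * (mon3 1 0 1))); last by rewrite
    /r1 /r2 /r3 /r4 /r5 /mon3; ring.
  by V_closed.
- rewrite (_ : mon3 2 2 0 = r1 * r4 + r2 * r2 + t2 * (mon3 2 1 0) + t1 * (mon3
    1 2 0) + t1 * (t2 * (mon3 1 0 1)) - r1 * r5 - t1 * (t2 * (mon3 1 1 0)) -
    t2 * (mon3 2 0 1) - t1 * (mon3 1 0 2)); last by rewrite /r1 /r2 /r3 /r4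
    /r5 /mon3; ring.
  by V_closed.
- rewrite (_ : mon3 3 0 1 = r1 * r2 + t1 * (mon3 2 0 1)); last by rewrite /r1
    /r2 /r3 /r4 /r5 /mon3; ring.
  by V_closed.
- rewrite (_ : mon3 3 1 0 = r1 * r3 + r2 * r2 + t1 * (mon3 2 1 0) + t1 * (mon3
    2 1 0) + t1 * (t2 * (mon3 1 0 1)) - r1 * r5 - t1 * (t1 * (mon3 1 1 0)) -
    t2 * (mon3 2 0 1) - t1 * (mon3 1 0 2)); last by rewrite /r1 /r2 /r3 /r4
    /r5 /mon3; ring.
  by V_closed.
- rewrite (_ : mon3 4 0 0 = r1 * r1 + t1 * (mon3 3 0 0) + t1 * (mon3 3 0 0) -
    t1 * (t1 * (mon3 2 0 0))); last by rewrite /r1 /r2 /r3 /r4 /r5 /mon3;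
    ring.
  by V_closed.

Qed.

End QuarticReduction.

(** * Cubics with five double points *)

Section CubicInterpolation.

Definition deg3 : seq (nat * nat * nat) :=
  [seq m <- [seq (p, k) | p <- [seq (i, j) | i <- iota 0 4, j <- iota 0 4],
    k <- iota 0 4]
     | m.1.1 + m.1.2 + m.2 <= 3]%N.

Lemma deg3E : deg3 = ltac:(let v := eval vm_compute in deg3 in exact v).
Proof. by []. Qed.

Variables (D : idomainType) (c : nat * nat * nat -> D).

Definition cubic (x y z : D) := \sum_(m <- deg3)
  c m * mon3 x y z m.1.1 m.1.2 m.2.
Definition cubic_dx (x y z : D) :=
  \sum_(m <- deg3) c m * (x ^+ m.1.1.-1 *+ m.1.1 * y ^+ m.1.2 * z ^+ m.2).
Definition cubic_dy (x y z : D) :=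
  \sum_(m <- deg3) c m * (x ^+ m.1.1 * (y ^+ m.1.2.-1 *+ m.1.2) * z ^+ m.2).
Definition cubic_dz (x y z : D) :=
  \sum_(m <- deg3) c m * (x ^+ m.1.1 * y ^+ m.1.2 * (z ^+ m.2.-1 *+ m.2)).

Definition double_point x y z :=
  [/\ cubic x y z = 0, cubic_dx x y z = 0,
    cubic_dy x y z = 0 & cubic_dz x y z = 0].

Let k i j l := c (i, j, l).

Lemma double_pointE x y z : double_point x y z ->
  [/\ k 0 0 0 + k 1 0 0 * x + k 0 1 0 * y + k 0 0 1 * z
      + k 2 0 0 * x ^+ 2 + k 0 2 0 * y ^+ 2 + k 0 0 2 * z ^+ 2
      + k 1 1 0 * x * y + k 1 0 1 * x * z + k 0 1 1 * y * z
      + k 3 0 0 * x ^+ 3 + k 0 3 0 * y ^+ 3 + k 0 0 3 * z ^+ 3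
      + k 2 1 0 * x ^+ 2 * y + k 1 2 0 * x * y ^+ 2
      + k 2 0 1 * x ^+ 2 * z + k 1 0 2 * x * z ^+ 2
      + k 0 2 1 * y ^+ 2 * z + k 0 1 2 * y * z ^+ 2 + k 1 1 1 * x * y * z = 0,
      k 1 0 0 + k 2 0 0 * 2 * x + k 1 1 0 * y + k 1 0 1 * z
      + k 3 0 0 * 3 * x ^+ 2 + k 2 1 0 * 2 * x * y + k 1 2 0 * y ^+ 2
      + k 2 0 1 * 2 * x * z + k 1 0 2 * z ^+ 2 + k 1 1 1 * y * z = 0,
      k 0 1 0 + k 0 2 0 * 2 * y + k 1 1 0 * x + k 0 1 1 * z
      + k 0 3 0 * 3 * y ^+ 2 + k 2 1 0 * x ^+ 2 + k 1 2 0 * 2 * x * y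
      + k 0 2 1 * 2 * y * z + k 0 1 2 * z ^+ 2 + k 1 1 1 * x * z = 0
    & k 0 0 1 + k 0 0 2 * 2 * z + k 1 0 1 * x + k 0 1 1 * y
      + k 0 0 3 * 3 * z ^+ 2 + k 2 0 1 * x ^+ 2 + k 1 0 2 * 2 * x * z
      + k 0 2 1 * y ^+ 2 + k 0 1 2 * 2 * y * z + k 1 1 1 * x * y = 0].
Proof.
rewrite /double_point /cubic /cubic_dx /cubic_dy /cubic_dz /mon3 deg3E
  !big_cons !big_nil /=.
by case=> e1 e2 e3 e4; split; [rewrite -e1|rewrite -e2|rewrite -e3|rewrite -e4];
  rewrite /k; ring.
Qed.

Let lin (x L : D) : L = 0 -> x = L -> x = 0. Proof. by move=> ->. Qed.

Let cancel (u x L : D) : u != 0 -> L = 0 -> u * x = L -> x = 0.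
Proof. by move=> u0 -> /eqP; rewrite mulf_eq0 (negPf u0) => /eqP. Qed.

(** On a line through two of the points the cubic has two double roots, hence vanishes. Only X, Y
    and Y - X are ever cancelled, so the characteristic does not matter. *)
Lemma cubic_interpolation (X Y : D) : X != 0 -> Y != 0 -> Y - X != 0 ->
    double_point 0 0 0 -> double_point X 0 0 -> double_point 0 0 Y ->
    double_point X Y 0 -> double_point 0 (Y - X) X ->
  {in deg3, forall m, c m = 0}.
Proof.
move=> X0 Y0 Z0 /double_pointE[v1 a1 b1 d1] /double_pointE[v2 a2 b2 d2].
move=> /double_pointE[v5 a5 b5 d5] /double_pointE[v3 a3 b3 d3].
move=> /double_pointE[v4 a4 b4 d4]; set Z := Y - X in Z0 v4 a4 b4 d4.
have z000 : k 0 0 0 = 0 by apply: (lin v1); ring.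
have z100 : k 1 0 0 = 0 by apply: (lin a1); ring.
have z010 : k 0 1 0 = 0 by apply: (lin b1); ring.
have z001 : k 0 0 1 = 0 by apply: (lin d1); ring.
rewrite !(z000, z100, z010, z001) in v2 a2 b2 d2 v5 a5 b5 d5 v3 a3 b3 d3 v4 a4
  b4 d4.
have aux2 (x y u v : D) : x = 0 -> y = 0 -> u * x + v * y = 0.
  by move=> -> ->; rewrite !mulr0 addr0.
(* On the first axis f = k200 x^2 + k300 x^3 by now, and X f'(X) - 2 f(X) = k300 X^3. *)
have z300 : k 3 0 0 = 0.
  by apply: (cancel (expf_neq0 3 X0) (aux2 _ _ X (-2) a2 v2)); ring.
rewrite !z300 in v2 a2 b2 d2 v5 a5 b5 d5 v3 a3 b3 d3 v4 a4 b4 d4.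
have z200 : k 2 0 0 = 0 by apply: (cancel (expf_neq0 2 X0) v2); ring.
have z003 : k 0 0 3 = 0.
  by apply: (cancel (expf_neq0 3 Y0) (aux2 _ _ Y (-2) d5 v5)); ring.
rewrite !(z200, z003) in v2 a2 b2 d2 v5 a5 b5 d5 v3 a3 b3 d3 v4 a4 b4 d4.
have z002 : k 0 0 2 = 0 by apply: (cancel (expf_neq0 2 Y0) v5); ring.
rewrite !z002 in v2 a2 b2 d2 v5 a5 b5 d5 v3 a3 b3 d3 v4 a4 b4 d4.
have e1 : k 1 1 0 + X * k 2 1 0 = 0 by apply: (cancel X0 b2); ring.
have e2 : k 1 0 1 + X * k 2 0 1 = 0 by apply: (cancel X0 d2); ring.
have f1 : k 1 0 1 + Y * k 1 0 2 = 0 by apply: (cancel Y0 a5); ring.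
have f2 : k 0 1 1 + Y * k 0 1 2 = 0 by apply: (cancel Y0 b5); ring.
have g1 : k 0 2 0 + Y * k 0 3 0 + X * k 1 2 0 = 0.
  by apply: (cancel (expf_neq0 2 Y0) (aux2 _ _ 1 (- (X * Y)) v3 e1)); ring.
have z030 : k 0 3 0 = 0.
  have g2 : 2 * k 0 2 0 + 3 * Y * k 0 3 0 + 2 * X * k 1 2 0 = 0.
    by apply: (cancel Y0 (aux2 _ _ 1 (- X) b3 e1)); ring.
  by apply: (cancel Y0 (aux2 _ _ 1 (-2) g2 g1)); ring.
rewrite !z030 in g1 v4 a4 b4 d4.
have g4 : X * k 2 1 0 + Y * k 1 2 0 = 0.
  by apply: (cancel Y0 (aux2 _ _ 1 (- Y) a3 e1)); ring.
have g5 : k 0 1 1 + Y * k 0 2 1 + X * k 1 1 1 = 0.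
  by apply: (cancel Y0 (aux2 _ _ 1 (- X) d3 e2)); ring.
have h1 : Z * k 0 2 0 + X * k 0 1 1 + Z * X * k 0 2 1 + X ^+ 2 * k 0 1 2 = 0.
  by apply: (cancel Z0 v4); ring.
have h2 : k 0 2 0 + X * k 0 2 1 = 0.
  by apply: (cancel Z0 (aux2 _ _ 1 (-1) b4 h1)); ring.
have h3 : k 0 1 1 + X * k 0 1 2 = 0.
  by apply: (cancel X0 (aux2 _ _ 1 (- Z) h1 h2)); ring.
have z012 : k 0 1 2 = 0.
  by apply: (cancel Z0 (aux2 _ _ 1 (-1) f2 h3)); rewrite /Z; ring.
have z011 : k 0 1 1 = 0 by apply: (lin h3); rewrite z012; ring.
rewrite !(z011, z012) in g5 a4 d4.
have z021 : k 0 2 1 = 0 by apply: (cancel (expf_neq0 2 Z0) d4); ring.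
have z020 : k 0 2 0 = 0 by apply: (lin h2); rewrite z021; ring.
have z120 : k 1 2 0 = 0 by apply: (cancel X0 g1); rewrite z020; ring.
have z210 : k 2 1 0 = 0 by apply: (cancel X0 g4); rewrite z120; ring.
have z110 : k 1 1 0 = 0 by apply: (lin e1); rewrite z210; ring.
have z111 : k 1 1 1 = 0 by apply: (cancel X0 g5); rewrite z021; ring.
have h4 : k 1 0 1 + X * k 1 0 2 = 0.
  by apply: (cancel X0 a4); rewrite z110 z120 z111; ring.
have z102 : k 1 0 2 = 0.
  by apply: (cancel Z0 (aux2 _ _ 1 (-1) f1 h4)); rewrite /Z; ring.
have z101 : k 1 0 1 = 0 by apply: (lin h4); rewrite z102; ring.
have z201 : k 2 0 1 = 0 by apply: (cancel X0 e2); rewrite z101; ring.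
suff /allP c0 : all (fun m => c m == 0) deg3 by move=> m /c0/eqP.
rewrite deg3E /=; rewrite /k in z000 z001 z002 z003 z010 z011 z012 z020 z021
  z030 z100 z101 z102 z110 z111 z120 z200 z201 z210 z300.
by rewrite z000 z001 z002 z003 z010 z011 z012 z020 z021 z030 z100 z101 z102
  z110 z111 z120 z200 z201 z210 z300 eqxx.
Qed.

End CubicInterpolation.

(** * The basis over the polynomial ring in th1 and th2 *)

Section Pentagon.
Variable K : fieldType.
Notation S := {mpoly K[5]}.
Notation A := {poly {poly K}}.
Notation I := (edge_square K (@cycle_graph 5)).

Definition px (i : nat) : S := 'X_(inord i).
Definition th1 : S := px 0 + px 4 + px 3.
Definition th2 : S := px 2 + px 1 + px 3.

Definition param : A -> S := eval2 (@mpolyC 5 K) th1 th2.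
HB.instance Definition _ := GRing.RMorphism.on param.

Definition cubic_comb (c : nat * nat * nat -> A) : S :=
  \sum_(m <- deg3) param (c m) * mon3 (px 4) (px 1) (px 3) m.1.1 m.1.2 m.2.

Lemma adj5 i j : (i < 5)%N -> (j < 5)%N ->
  (j == i.+1 %% 5)%N || (i == j.+1 %% 5)%N ->
    cycle_graph (inord i : 'I_5) (inord j).
Proof. by move=> i5 j5; rewrite /cycle_graph -!val_eqE /= !inordK. Qed.

Lemma edge5 i j : (i < 5)%N -> (j < 5)%N ->
  (j == i.+1 %% 5)%N || (i == j.+1 %% 5)%N ->
    px i * px j \in edge_ideal K (@cycle_graph 5).
Proof. by move=> i5 j5 ij; apply: edge_ideal_mem; apply: adj5. Qed.

Lemma edge_square_mul (f g : S) : f \in edge_ideal K (@cycle_graph 5) ->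
  g \in edge_ideal K (@cycle_graph 5) -> f * g \in I.
Proof. by move=> fI gI; apply: mem_ideal_span; exists f, g. Qed.

Lemma px_ind (P : S -> Prop) :
    (forall c, P c%:MP) -> (forall p q, P p -> P q -> P (p + q)) ->
    (forall i p, (i < 5)%N -> P p -> P (px i * p)) ->
  forall p, P p.
Proof.
move=> PC PD PX; elim/mpoly_gen_ind => // i p Pp.
by have := PX i p (ltn_ord i) Pp; rewrite /px inord_val.
Qed.

Lemma paramN p : param (- p) = - param p. Proof. exact: rmorphN. Qed.

Lemma cubic_combD c d :
  cubic_comb c + cubic_comb d = cubic_comb (fun m => c m + d m).
Proof.
by rewrite -big_split; apply: eq_bigr => m _; rewrite rmorphD mulrDl.
Qed.

Lemma cubic_combM p c : param p * cubic_comb c = cubic_comb (fun m => p * c m).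
Proof. by rewrite mulr_sumr; apply: eq_bigr => m _; rewrite rmorphM mulrA. Qed.

Lemma cubic_comb_eq0 c : {in deg3, forall m, c m = 0} -> cubic_comb c = 0.
Proof.
by move=> c0; rewrite /cubic_comb big_seq big1 // => m /c0 ->;
  rewrite rmorph0 mul0r.
Qed.

(** Modulo I^2 the combinations of cubic monomials absorb the quartic ones by [quartic_reduction].
    They are therefore stable under x4, x1, x3, and under x0 and x2 through th1 and th2. *)
Theorem cubic_spanning (s : S) : exists c, s - cubic_comb c \in I.
Proof.
pose V s := exists c, s - cubic_comb c \in I.
have VD x y : V x -> V y -> V (x + y).
  move=> [c xI] [d yI]; exists (fun m => c m + d m).
  by rewrite -cubic_combD opprD addrACA rpredD.
have VM p x : V x -> V (param p * x).
  move=> [c xI]; exists (fun m => p * c m).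
  by rewrite -cubic_combM -mulrBr; apply: idealMr.
have VN x : V x -> V (- x).
  by move=> /(VM (-1)); rewrite rmorphN rmorph1 mulN1r.
have VI x : x \in I -> V x.
  by exists (fun=> 0); rewrite cubic_comb_eq0 ?subr0.
have t1E : param 'X%:P = th1 by apply: eval2CX.
have t2E : param 'X = th2 by apply: eval2X.
have V1 x : V x -> V (th1 * x) by rewrite -t1E; apply: VM.
have V2 x : V x -> V (th2 * x) by rewrite -t2E; apply: VM.
pose mon := mon3 (px 4) (px 1) (px 3).
have Vmon i j k : (i + j + k <= 3)%N -> V (mon i j k).
  move=> ijk; exists (fun m => (m == (i, j, k))%:R).
  have md : (i, j, k) \in deg3.
    rewrite mem_filter; apply/andP; split=> //; apply/allpairsP;
      exists ((i, j), k); split=> //.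
      by apply/allpairsP; exists (i, j); rewrite !mem_iota; split=> //=; lia.
    by rewrite mem_iota /=; lia.
  have ud : uniq deg3 by [].
  rewrite /cubic_comb (bigD1_seq _ md ud) /=.
  rewrite eqxx rmorph1 mul1r big1 ?addr0 ?subrr ?rpred0 // => m /negPf->.
  by rewrite rmorph0 mul0r.
have V4 i j k : (i + j + k)%N = 4 -> V (mon i j k).
  apply: (quartic_reduction VD VN V1 V2 Vmon) => x y xr yr; apply/VI.
  have rI r : r \in [:: px 4 ^+ 2 - th1 * px 4; px 4 * px 3;
      px 4 * px 1 + px 1 * px 3 - th1 * px 1;
        px 1 ^+ 2 + px 1 * px 3 - th2 * px 1;
      px 3 ^+ 2 + px 1 * px 3 - th2 * px 3] ->
        r \in edge_ideal K (@cycle_graph 5).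
    have e04 := @edge5 0 4 isT isT isT; have e34 := @edge5 4 3 isT isT isT.
    have e01 := @edge5 0 1 isT isT isT; have e21 := @edge5 2 1 isT isT isT.
    have e23 := @edge5 2 3 isT isT isT.
    rewrite !inE => /or4P[/eqP->|/eqP->|/eqP->|/orP[]/eqP->] //.
    - by rewrite (_ : _ - _ = - (px 0 * px 4) - px 4 * px 3)
        ?rpredB ?rpredN // /th1; ring.
    - by rewrite (_ : _ - _ = - (px 0 * px 1)) ?rpredN // /th1; ring.
    - by rewrite (_ : _ - _ = - (px 2 * px 1)) ?rpredN // /th2; ring.
    - by rewrite (_ : _ - _ = - (px 2 * px 3)) ?rpredN // /th2; ring.
  by apply: edge_square_mul; apply: rI.
have Vmon4 i j k : (i + j + k <= 4)%N -> V (mon i j k).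
  by rewrite leq_eqVlt => /predU1P[/V4 //|]; apply: Vmon.
have VMx x : (forall i j k, (i + j + k <= 3)%N -> V (x * mon i j k)) ->
    forall u, V u -> V (x * u).
  move=> Vx u [c uI]; rewrite -[X in x * X](subrK (cubic_comb c)) mulrDr.
  apply: (VD); first by apply/VI/idealMr.
  rewrite mulr_sumr big_seq; elim/big_rec: _ => [|m y md Vy].
    by apply: VI; rewrite rpred0.
  apply: (VD) => //; rewrite mulrCA; apply/VM/Vx.
  by move: md; rewrite mem_filter => /andP[].
have Va u : V u -> V (px 4 * u).
  apply: VMx => i j k ijk; rewrite (_ : _ * _ = mon i.+1 j k);
    first exact: Vmon4.
  by rewrite /mon /mon3 exprS !mulrA.
have Vb u : V u -> V (px 1 * u).
  apply: VMx => i j k ijk; rewrite (_ : _ * _ = mon i j.+1 k).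
    by apply: Vmon4; rewrite addnS addSn.
  by rewrite /mon /mon3 exprS; ring.
have Vc u : V u -> V (px 3 * u).
  apply: VMx => i j k ijk; rewrite (_ : _ * _ = mon i j k.+1).
    by apply: Vmon4; rewrite addnS.
  by rewrite /mon /mon3 exprS; ring.
apply: (px_ind (P := V)) s => [c|//|[|[|[|[|[|//]]]]] p _ Vp].
- have := VM c%:P%:P _ (Vmon 0%N 0%N 0%N isT).
  by rewrite /param eval2CC /mon /mon3 !expr0 !mulr1.
- rewrite (_ : px 0 * p = th1 * p - px 4 * p - px 3 * p);
    last by rewrite /th1; ring.
  by apply: (VD); [apply: VD; [exact: V1 | apply/VN/Va] | apply/VN/Vc].
- exact: Vb.
- rewrite (_ : px 2 * p = th2 * p - px 1 * p - px 3 * p);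
    last by rewrite /th2; ring.
  by apply: (VD); [apply: VD; [exact: V2 | apply/VN/Vb] | apply/VN/Vc].
- exact: Vc.
- exact: Va.
Qed.

Section Point.
Variables a b c : A.
Let X : A := 'X%:P.
Let Y : A := 'X.

(* The A-point of Spec S with coordinates (a, b, c) over the parameter ring. *)
Definition point : S -> A := mmap (polyC \o @polyC K)
  (fun i : 'I_5 => nth 0 [:: X - a - c; b; Y - b - c; c; a] i).
HB.instance Definition _ := GRing.RMorphism.on point.

Lemma pointX i : (i < 5)%N ->
  point (px i) = nth 0 [:: X - a - c; b; Y - b - c; c; a] i.
Proof. by move=> i5; rewrite /point mmapX mmap1U inordK. Qed.

Lemma pointC x : point x%:MP = x%:P%:P.
Proof. exact: mmapC. Qed.

Lemma point_th1 : point th1 = X.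
Proof. by rewrite /th1 !rmorphD /= !pointX //=; ring. Qed.

Lemma point_th2 : point th2 = Y.
Proof. by rewrite /th2 !rmorphD /= !pointX //=; ring. Qed.

Lemma pointK : cancel param point.
Proof.
have pointKC q : point (param q%:P) = q%:P.
  elim/poly_ind: q => [|q x IHq]; first by rewrite !rmorph0.
  rewrite polyCD polyCM !(rmorphD, rmorphM) /= IHq.
  by rewrite /param eval2CX point_th1 eval2CC pointC.
elim/poly_ind => [|p q IHp]; first by rewrite !rmorph0.
by rewrite !(rmorphD, rmorphM) /= IHp pointKC /param eval2X point_th2.
Qed.

Hypothesis on_curve : [/\ (X - a - c) * b = 0, b * (Y - b - c) = 0,
  (Y - b - c) * c = 0, c * a = 0 & a * (X - a - c) = 0].

Lemma point_edge (f : S) : f \in edge_ideal K (@cycle_graph 5) -> point f = 0.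
Proof.
have iJ : is_ideal (fun f : S => point f = 0).
  split=> [|g u v u0 v0]; first by rewrite rmorph0.
  by rewrite rmorphD rmorphM /= u0 v0 mulr0 addr0.
move=> fI; apply: (ideal_span_min iJ _ fI) => _ [i [j [ij ->]]].
have [o1 o2 o3 o4 o5] := on_curve.
have E (i' : 'I_5) : 'X_i' = px i' by rewrite /px inord_val.
rewrite rmorphM /= !E !pointX //.
move: ij; case: i j => [[|[|[|[|[|//]]]]] ?] [[|[|[|[|[|//]]]]] ?] //= _;
  by rewrite // mulrC.
Qed.

Definition derivative (w : 'I_5 -> A) (f : S) : A :=
  \sum_i w i * point (f^`M(i)).

Lemma derivativeD w f g : derivative w (f + g)
  = derivative w f + derivative w g.
Proof.
by rewrite -big_split; apply: eq_bigr => i _; rewrite mderivD rmorphD mulrDr.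
Qed.

Lemma derivativeM w f g :
  derivative w (f * g) = derivative w f * point g + point f * derivative w g.
Proof.
rewrite mulr_suml mulr_sumr -big_split; apply: eq_bigr => i _ /=.
by rewrite mderivM rmorphD !rmorphM /=; ring.
Qed.

Lemma derivativeC w x : derivative w x%:MP = 0.
Proof. by apply: big1 => i _; rewrite mderivC rmorph0 mulr0. Qed.

Lemma derivativeX w i : derivative w 'X_i = w i.
Proof.
rewrite /derivative (bigD1 i) //= big1 ?addr0 => [|j /negPf ji].
  rewrite mderivX mnm1E eqxx scale1r -[X in (X - _)%MM]add0m addmK.
  by rewrite mpolyX0 rmorph1 mulr1.
by rewrite mderivX mnm1E eq_sym ji scale0r rmorph0 mulr0.
Qed.

Lemma derivativeXn w f n :
  derivative w (f ^+ n) = point f ^+ n.-1 *+ n * derivative w f.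
Proof.
elim: n => [|n IHn]; first by rewrite expr0 -mpolyC1 derivativeC mulr0n mul0r.
rewrite exprS derivativeM IHn rmorphXn /=; case: n {IHn} => [|n].
  by rewrite expr0 mulr0n; ring.
by rewrite mulrA mulrnAr -exprS [_ * point f ^+ _]mulrC -mulrDl -mulrS.
Qed.

Lemma derivative_sum w (T : Type) (r : seq T) (F : T -> S) :
  derivative w (\sum_(x <- r) F x) = \sum_(x <- r) derivative w (F x).
Proof.
elim: r => [|x r IHr]; last by rewrite !big_cons derivativeD IHr.
by rewrite !big_nil -(mpolyC0 5) derivativeC.
Qed.

(** By the Leibniz rule, a derivation along the point kills every product of two elements that
    vanish there. *)
Lemma derivative_square w f : f \in I -> derivative w f = 0.
Proof.
have iJ : is_ideal (fun f : S => point f = 0 /\ derivative w f = 0).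
  split=> [|g u v [u0 du0] [v0 dv0]].
    by rewrite rmorph0 -(mpolyC0 5) derivativeC.
  rewrite rmorphD rmorphM /= derivativeD derivativeM u0 v0 du0 dv0.
  by rewrite !mulr0 !addr0.
move=> fI; apply: (ideal_span_min iJ _ fI).2 => _ [g [h [gI hI ->]]].
by rewrite rmorphM derivativeM /= (point_edge gI) (point_edge hI)
  !mulr0 mul0r addr0.
Qed.

(* Directions along which both parameters are constant. *)
Definition direction (u v w : A) (i : 'I_5) : A :=
  nth 0 [:: - u - w; v; - v - w; w; u] i.

Lemma derivative_px u v w i : (i < 5)%N ->
  derivative (direction u v w) (px i) = nth 0 [:: - u - w; v; - v - w; w; u] i.
Proof. by move=> i5; rewrite derivativeX /direction inordK. Qed.

Lemma derivative_param u v w p : derivative (direction u v w) (param p) = 0.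
Proof.
have d1 : derivative (direction u v w) th1 = 0.
  by rewrite /th1 !derivativeD !derivative_px //=; ring.
have d2 : derivative (direction u v w) th2 = 0.
  by rewrite /th2 !derivativeD !derivative_px //=; ring.
have dC q : derivative (direction u v w) (param q%:P) = 0.
  elim/poly_ind: q => [|q x IHq]; first by rewrite rmorph0 -(mpolyC0 5)
    derivativeC.
  rewrite polyCD polyCM !(rmorphD, rmorphM) /= derivativeD derivativeM IHq.
  by rewrite /param eval2CX eval2CC d1 derivativeC mulr0 mul0r !addr0.
elim/poly_ind: p => [|p q IHp]; first by rewrite rmorph0 -(mpolyC0 5)
  derivativeC.
rewrite !(rmorphD, rmorphM) /= derivativeD derivativeM IHp dC.
by rewrite /param eval2X d2 mulr0 mul0r !addr0.
Qed.

(** The coefficients are constant along [direction] and [point] inverts [param], so value and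
    derivatives of the combination at the point are those of the cubic with coefficients [d]. *)
Lemma double_point_square (d : nat * nat * nat -> A) :
  cubic_comb d \in I -> double_point d a b c.
Proof.
move=> dI.
have p4 : point (px 4) = a by rewrite pointX.
have p1 : point (px 1) = b by rewrite pointX.
have p3 : point (px 3) = c by rewrite pointX.
have der u v w : derivative (direction u v w) (cubic_comb d) =
    u * cubic_dx d a b c + v * cubic_dy d a b c + w * cubic_dz d a b c.
  rewrite derivative_sum !mulr_sumr -!big_split; apply: eq_bigr => m _ /=.
  rewrite derivativeM derivative_param mul0r add0r pointK.
  rewrite /mon3 !derivativeM !derivativeXn !derivative_px //= !(rmorphM,
    rmorphXn) /=.
  by rewrite p4 p1 p3; ring.
have val : point (cubic_comb d) = cubic d a b c.
  rewrite rmorph_sum; apply: eq_bigr => m _.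
  by rewrite rmorphM /= pointK /mon3 !(rmorphM, rmorphXn) /= p4 p1 p3.
split.
- rewrite -val; have iJ : is_ideal (fun f : S => point f = 0).
    split=> [|g u v u0 v0]; first by rewrite rmorph0.
    by rewrite rmorphD rmorphM /= u0 v0 mulr0 addr0.
  apply: (ideal_span_min iJ _ dI) => _ [g [h [gI _ ->]]].
  by rewrite rmorphM /= (point_edge gI) mul0r.
- by have := der 1 0 0; rewrite derivative_square // => ->; ring.
- by have := der 0 1 0; rewrite derivative_square // => ->; ring.
- by have := der 0 0 1; rewrite derivative_square // => ->; ring.
Qed.

End Point.

(** The five points have, in this order, their nonzero coordinates at the independent pairs {0, 2},
    {2, 4}, {0, 3}, {1, 4} and {1, 3}, one for each minimal prime of I. *)
Theorem cubic_independence (d : nat * nat * nat -> A) :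
  cubic_comb d \in I -> {in deg3, forall m, d m = 0}.
Proof.
move=> dI; apply: (@cubic_interpolation _ _ ('X%:P) ('X)).
- by rewrite polyC_eq0 polyX_eq0.
- by rewrite polyX_eq0.
- by rewrite polyXsubC_eq0.
all: by apply: double_point_square dI; split; ring.
Qed.

End Pentagon.

Arguments px {K} i.
Arguments th1 {K}.
Arguments th2 {K}.

(** * Depth and height at the maximal ideals of the pentagon quotient *)

Section PentagonCohenMacaulay.
Variable K : fieldType.
Notation S := {mpoly K[5]}.
Notation A := {poly {poly K}}.
Notation I := (edge_square K (@cycle_graph 5)).
Notation Q := {ideal_quot I}.

Let pi : {rmorphism S -> Q} := quotient_map I.
Let kappa : {rmorphism K -> Q} := pi \o @mpolyC 5 K.

Let pi_surj x : exists f, pi f = x. Proof. exact: quotient_map_surj. Qed.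
Let pi_eq0 f : pi f = 0 <-> f \in I. Proof. exact: quotient_map_eq0. Qed.

Lemma prime_contains_edge (P : Q -> Prop) i j : is_prime P ->
    (i < 5)%N -> (j < 5)%N -> (j == i.+1 %% 5)%N || (i == j.+1 %% 5)%N ->
  P (pi (px i)) \/ P (pi (px j)).
Proof.
move=> [iP _ PM] i5 j5 ij.
have : P (pi (px i * px j * (px i * px j))).
  have -> : pi (px i * px j * (px i * px j)) = 0.
    by apply/pi_eq0/edge_square_mul; apply: edge5.
  exact: ideal0.
by rewrite rmorphM => /PM[]; rewrite rmorphM => /PM.
Qed.

Definition contains3 (P : Q -> Prop) i j k :=
  [/\ P (pi (px i)), P (pi (px j)) & P (pi (px k))].

Lemma prime_vertex_cover (P : Q -> Prop) : is_prime P ->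
  [\/ contains3 P 4 1 3, contains3 P 0 1 3, contains3 P 0 2 3
    | contains3 P 4 0 2 \/ contains3 P 4 1 2].
Proof.
move=> pP; rewrite /contains3.
have := @prime_contains_edge P 0 1 pP isT isT isT.
have := @prime_contains_edge P 1 2 pP isT isT isT.
have := @prime_contains_edge P 2 3 pP isT isT isT.
have := @prime_contains_edge P 3 4 pP isT isT isT.
have := @prime_contains_edge P 4 0 pP isT isT isT.
move=> [p4|p0] [p3|p4'] [p2|p3'] [p1|p2'] [p0'|p1'];
  by [constructor 1; split | constructor 2; split | constructor 3; split
     | constructor 4; left; split | constructor 4; right; split].
Qed.

Lemma prime_chain_leq2 n (c : nat -> Q -> Prop) : (forall i, is_prime (c i)) ->
    (forall i, (i < n)%N ->
       (forall x, c i x -> c i.+1 x) /\ ~ (forall x, c i.+1 x -> c i x)) ->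
  (n <= 2)%N.
Proof.
move=> pc cS.
suff [i [j H]] : exists i j, forall k, (k < 5)%N -> k != i -> k != j ->
  c 0%N (pi (px k)).
  apply: leq_trans (prime_chain_leq pi_surj (W := [set inord i;
    inord j]) pc cS _) _.
    move=> k; rewrite !inE negb_or => /andP[ki kj].
    have -> : 'X_k = px k by rewrite /px inord_val.
    by apply: H => //; [apply: contraNneq ki => <- | apply: contraNneq kj =>
      <-];
      rewrite inord_val.
  by rewrite cards2; case: eqP.
by case: (prime_vertex_cover (pc 0%N)) => [[]|[]|[]|[[]|[]]] p q r;
  [exists 0%N, 2%N | exists 2%N, 4%N | exists 1%N, 4%N | exists 1%N,
    3%N | exists 0%N, 3%N];
  move=> [|[|[|[|[|//]]]]].
Qed.

Lemma rmorph_eval2 (q : A) u v :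
  pi (eval2 (@mpolyC 5 K) u v q) = eval2 kappa (pi u) (pi v) q.
Proof.
have EC (p : {poly K}) : pi (eval2 (@mpolyC 5 K) u v p%:P)
  = eval2 kappa (pi u) (pi v) p%:P.
  elim/poly_ind: p => [|p x IHp]; first by rewrite !rmorph0.
  rewrite polyCD polyCM !(rmorphD, rmorphM) /= IHp.
  by rewrite !eval2CX !eval2CC.
elim/poly_ind: q => [|q p IHq]; first by rewrite !rmorph0.
by rewrite !(rmorphD, rmorphM) /= IHq EC !eval2X.
Qed.

(** M contains the variables of a vertex cover, and modulo these the two remaining variables are
    linear combinations of th1 and th2. Both orders of the parameters are covered, as
    [maximal_meets_line] yields a polynomial in the first one only. *)
Lemma maximal_parametrized (M : idealr Q) (u v : S) : maximal_ideal M ->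
    (u = th1 /\ v = th2) \/ (u = th2 /\ v = th1) ->
  forall s, exists f, s - eval2 kappa (pi u) (pi v) f \in M.
Proof.
move=> maxM uv.
pose G (x : S) := exists f, pi x - eval2 kappa (pi u) (pi v) f \in M.
have GD x y : G x -> G y -> G (x + y).
  move=> [f xM] [g yM]; exists (f + g).
  by rewrite !rmorphD /= opprD addrACA; apply: rpredD.
have GC c : G c%:MP by exists c%:P%:P; rewrite eval2CC subrr rpred0.
have GM x y : G x -> G y -> G (x * y).
  move=> [f xM] [g yM]; exists (f * g); rewrite !rmorphM /=.
  set x' := pi x in xM *; set y' := pi y in yM *.
  set f' := eval2 _ _ _ f in xM *; set g' := eval2 _ _ _ g in yM *.
  have -> : x' * y' - f' * g' = y' * (x' - f') + f' * (y' - g') by ring.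
  by rewrite rpredD // idealMr.
have GN x : G x -> G (- x).
  by move=> Gx; rewrite -mulN1r; apply: GM => //; rewrite -(mpolyC1 5) -mpolyCN.
have GM0 x : pi x \in M -> G x by exists 0; rewrite rmorph0 subr0.
have [G1 G2] : G th1 /\ G th2.
  have Gu : G u by exists 'X%:P; rewrite eval2CX subrr rpred0.
  have Gv : G v by exists 'X; rewrite eval2X subrr rpred0.
  by case: uv Gu Gv => -[-> ->].
have G5 i : (i < 5)%N -> G (px i).
  suff [G4 [Gp1 G3]] : G (px 4) /\ G (px 1) /\ G (px 3).
    case: i => [|[|[|[|[|//]]]]] _ //.
      rewrite (_ : px 0 = th1 + - px 4 + - px 3 :> S); last by rewrite /th1;
        ring.
      by apply: (GD); [apply: GD => //|]; apply: GN.
    rewrite (_ : px 2 = th2 + - px 1 + - px 3 :> S); last by rewrite /th2; ring.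
    by apply: (GD); [apply: GD => //|]; apply: GN.
  have E4 : px 4 = th1 + - px 0 + - px 3 :> S by rewrite /th1; ring.
  have E1 : px 1 = th2 + - px 2 + - px 3 :> S by rewrite /th2; ring.
  have E3 : px 3 = th1 + - px 0 + - px 4 :> S by rewrite /th1; ring.
  have E3' : px 3 = th2 + - px 1 + - px 2 :> S by rewrite /th2; ring.
  case: (prime_vertex_cover (maximal_prime maxM)) => [[]|[]|[]|[[]|[]]];
    move=> /GM0 p /GM0 q /GM0 r.
  - by [].
  - by split=> //; rewrite E4; apply: (GD); [apply: GD => //|]; apply: GN.
  - split; first by rewrite E4; apply: (GD); [apply: GD => //|]; apply: GN.
    by split=> //; rewrite E1; apply: (GD); [apply: GD => //|]; apply: GN.
  - have G3 : G (px 3) by rewrite E3; apply: (GD); [apply: GD => //|];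
      apply: GN.
    by split=> //; split=> //; rewrite E1; apply: (GD); [apply: GD => //|];
      apply: GN.
  - by split=> //; split=> //; rewrite E3'; apply: (GD); [apply: GD => //|];
      apply: GN.
move=> s; have [x <-] := pi_surj s; rewrite -/(G x).
apply: (px_ind (P := G)) x => // i x i5 Gx.
by apply: GM => //; apply: G5.
Qed.

Lemma horner_param1 (q : {poly K}) :
  (map_poly kappa q).[pi th1] = pi (param q%:P).
Proof. by rewrite /param rmorph_eval2 eval2C. Qed.

Lemma horner_param2 (q : {poly K}) :
  (map_poly kappa q).[pi th2] = pi (param (map_poly polyC q)).
Proof.
rewrite /param rmorph_eval2; elim/poly_ind: q => [|q x IHq].
  by rewrite !rmorph0 horner0.
have mapMXaddC (B : comNzRingType) (f : {rmorphism K -> B}) :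
  map_poly f (q * 'X + x%:P) = map_poly f q * 'X + (f x)%:P.
  by rewrite rmorphD rmorphM /= map_polyX map_polyC.
rewrite !mapMXaddC hornerMXaddC IHq.
by rewrite (rmorphD (eval2 _ _ _)) (rmorphM (eval2 _ _ _)) /= eval2X eval2CC.
Qed.

(* The quotient is free over the polynomial ring in th1 and th2, so p(th1) and
   q(th2) form a regular sequence. *)
Lemma param_regular (p q : {poly K}) : p != 0 -> q != 0 ->
    1 \notin ideal_of_seq [:: pi (param p%:P); pi (param (map_poly polyC q))] ->
  regular_sequence [:: pi (param p%:P); pi (param (map_poly polyC q))].
Proof.
move=> p0 q0 n1; split=> // -[|[|//]] _ r; have [s <-] := pi_surj r;
  have [c sI] := cubic_spanning s.
- rewrite /= !ideal_of_seq_nil -rmorphM !pi_eq0 mulrC => psI.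
  have cI : cubic_comb (fun m => p%:P * c m) \in I.
    rewrite -cubic_combM -[cubic_comb c](subKr s) mulrBr.
    by rewrite rpredB // idealMr.
  rewrite cubic_comb_eq0 ?subr0 // in sI => m md;
    have /eqP := cubic_independence cI md.
  by rewrite mulf_eq0 polyC_eq0 (negPf p0) => /eqP.
- rewrite /= => /ideal_of_seq_cons[y /ideal_of_seq_nil E].
  apply/ideal_of_seq_cons; have [y' yE] := pi_surj y.
  have [d yI] := cubic_spanning y'; rewrite -{y}yE in E.
  have {}E : s * param (map_poly polyC q) - y' * param p%:P \in I.
    by apply/pi_eq0; rewrite rmorphB !rmorphM.
  have cI : cubic_comb (fun m => map_poly polyC q * c m + (- p%:P) * d m) \in I.
    rewrite -[cubic_comb _](cubic_combD (fun m => map_poly polyC q * c m)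
      (fun m => (- p%:P) * d m)) -[X in X + _]cubic_combM -[X in _ +
        X]cubic_combM.
    rewrite paramN mulNr.
    set f := param _ in E *; set g := param _ in E *.
    set N := cubic_comb c in sI *; set N' := cubic_comb d in yI *.
    have -> : f * N - g * N' = (s * f - y' * g) - f * (s - N) + g * (y' - N')
      by ring.
    by apply: rpredD; [apply: rpredB => //|]; apply: idealMr.
  (* Freeness turns the relation into q c_m = p d_m in A. As p and q involve different variables,
     the leading coefficient of q is a nonzero constant, coprime to p, and p divides c_m. *)
  have /choice[e eE] m : exists e, m \in deg3 -> c m = p%:P * e.
    have [md|] := boolP (m \in deg3); last by exists 0.
    have /eqP := cubic_independence cI md; rewrite mulNr subr_eq0 => /eqP cd.
    have [||||e ->] := @polyC_dvd K p (map_poly polyC q) (c m) (d m) 0;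
      last by exists e.
    + rewrite lead_coef_map_inj ?rmorph0 //; last exact: polyC_inj.
      by rewrite -alg_polyC coprimepZr ?coprimep1 ?lead_coef_eq0.
    + by [].
    + by rewrite size_poly0 size_map_inj_poly ?rmorph0 ?size_poly_gt0 //;
        apply: polyC_inj.
    + by rewrite addr0.
  exists (pi (cubic_comb e)); apply/ideal_of_seq_nil.
  rewrite -rmorphM -rmorphB; apply/pi_eq0.
  have -> : cubic_comb e * param p%:P = cubic_comb c.
    rewrite mulrC cubic_combM; rewrite /cubic_comb big_seq [RHS]big_seq.
    by apply: eq_bigr => m md; rewrite -eE.
  exact: sI.
Qed.

Lemma regular_sequence_chain (M : idealr Q) s : maximal_ideal M ->
  {subset s <= M} -> regular_sequence s -> prime_chain M (size s).
Proof.
move=> maxM sM /regular_weakly reg.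
have i0 : is_ideal (fun x : Q => x = 0).
  by split=> // b u v -> ->; rewrite mulr0 addr0.
have := ladder_prime_chain (weakly_regular_ladder i0 reg) (maximal_prime maxM).
case=> [x|c [pc cS cM]].
  rewrite take_size => /foldl_ideal_add0; exact: (ideal_of_seq_min
    (idealr_ideal M)).
by apply/prime_chainP; exists c; split=> // x; rewrite cM.
Qed.

Lemma pentagon_cohen_macaulay : cohen_macaulay Q.
Proof.
split; first by apply: (noetherian_surj pi_surj); exact: noetherian_mpoly.
move=> M maxM; exists 2%N.
have ub n : prime_chain M n -> (n <= 2)%N.
  by move=> /prime_chainP[c [pc cS _]]; apply: prime_chain_leq2 cS.
have [p p0 pM] := maximal_meets_line maxM (maximal_parametrized maxM (or_introl
  (conj erefl erefl))).
have [q q0 qM] := maximal_meets_line maxM (maximal_parametrized maxM (or_intror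
  (conj erefl erefl))).
rewrite horner_param1 in pM; rewrite horner_param2 in qM.
set s := [:: pi (param p%:P); pi (param (map_poly polyC q))].
have sM : {subset s <= M} by move=> x; rewrite !inE => /orP[]/eqP->.
have reg : regular_sequence s.
  apply: param_regular => //; apply/negP => s1.
  have : 1 \in M by exact: (ideal_of_seq_min (idealr_ideal M) sM s1).
  by rewrite idealr1.
split.
  split; first by exists s.
  by move=> s' s'M reg'; apply/ub/regular_sequence_chain.
by split=> //; apply: (regular_sequence_chain maxM sM reg).
Qed.

End PentagonCohenMacaulay.

Theorem theorem3p2 (K : fieldType) (t : nat) (ht : (3 <= t)%N) :
  cohen_macaulay
    {ideal_quot ideal_mul (edge_ideal K (@cycle_graph t))
                          (edge_ideal K (@cycle_graph t))} <-> t = 5%N.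
Proof.
split=> [cm|->]; last exact: pentagon_cohen_macaulay.
have [t6|] := leqP 6 t.
  have [t7|t7] := eqVneq t 7; last by case: (not_cm_large t6 t7 cm).
  by subst t; case: (not_cm_heptagon cm).
case: t ht cm => [|[|[|[|[|[|t]]]]]] // _ cm _.
  by case: (not_cm_triangle cm).
by case: (not_cm_square cm).
Qed.
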